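(* Let $\lambda$ be a Young diagram and let $X=(X_{i,j})_{(i,j)\in\lambda}$ be a random tableau of shape $\lambda$ with i.i.d. geometric or i.i.d. exponential entries. Let $L$ and $L^*$ be the corresponding LPP tableau and dual LPP tableau. Then the border strip entries (and in particular the corner entries) of $L$ and $L^*$ have the same joint distribution; that is, $(L_{i,j})_{(i,j)\in\mathcal{B}}\overset{D}{=}(L^*_{i,j})_{(i,j)\in\mathcal{B}}$, where $\mathcal{B}$ is the border strip of $\lambda$.
   Context: Boxes of a Young diagram $\lambda$ are identified with positions $(i,j)\in\mathbb{N}^2$, $i$ the row and $j$ the column index (both starting from $1$). A box $(i,j)\in\lambda$ is a border box if $(i+1,j+1)\notin\lambda$; the border strip $\mathcal{B}$ of $\lambda$ is the set of its border boxes. A box $(i,j)\in\lambda$ is a corner if $\lambda\setminus\{(i,j)\}$ is a Young diagram (every corner is a border box). A tableau of shape $\lambda$ is an array $\{x_{i,j}:(i,j)\in\lambda\}$ of non-negative real numbers. A directed lattice path from $(a,b)$ to $(c,d)$ is a sequence $((i_k,j_k))_{k=0}^m$ of minimal length $m=|c-a|+|d-b|$ with $(i_0,j_0)=(a,b)$, $(i_m,j_m)=(c,d)$, $|i_{k+1}-i_k|+|j_{k+1}-j_k|=1$. Put $L(a,b;c,d):=\max_{\pi:(a,b)\to(c,d)}\sum_{(i,j)\in\pi}X_{i,j}$, the maximum being over directed lattice paths. The LPP tableau $L=(L_{i,j})_{(i,j)\in\lambda}$ and dual LPP tableau $L^*=(L^*_{i,j})_{(i,j)\in\lambda}$ are defined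 by $$L_{i,j}:=L(1,1;i,j),\qquad L^*_{i,j}:=L(i,1;1,j),\qquad (i,j)\in\lambda$$ (all paths involved stay in the rectangle $[1,i]\times[1,j]\subseteq\lambda$). A random variable $G$ is called geometric if, for some integer $k\ge0$ and some $p\in(0,1)$, $\mathbb{P}(G=m)=p(1-p)^{m-k}$ for all integers $m\ge k$. Exponential means exponential of an arbitrary rate $\alpha>0$. $\overset{D}{=}$ denotes equality of joint distributions. *)

(* Defs.v *)
From HB Require Import structures.
From mathcomp Require Import all_boot all_order all_algebra.
From mathcomp Require Import finmap.
From mathcomp Require Import all_classical all_reals all_analysis.

Set Implicit Arguments.
Unset Strict Implicit.
Unset Printing Implicit Defensive.

Import Order.TTheory GRing.Theory Num.Theory.
Import numFieldNormedType.Exports.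

Local Open Scope classical_set_scope.
Local Open Scope fset_scope.
Local Open Scope ring_scope.

(* Row and column indices start from 1; no box of a Young diagram has a zero
   coordinate. *)
Notation box := (nat * nat)%type.

(* [rows i] is the length of row [i]; its value at [i = 0] is irrelevant. *)
Definition young_diagram (D : {fset box}) : Prop :=
  exists2 rows : nat -> nat,
    forall i j, (0 < i)%N -> (i <= j)%N -> (rows j <= rows i)%N &
    forall i j, ((i, j) \in D) = [&& 0 < i, 0 < j & j <= rows i]%N.

Definition border_strip (D : {fset box}) : {fset box} :=
  [fset b in D | (b.1.+1, b.2.+1) \notin D].

Definition corners (D : {fset box}) : {fset box} :=
  [fset b in D | `[< young_diagram (D `\ b) >]].

Definition grid_dist (a b : box) : nat := (`|a.1 - b.1| + `|a.2 - b.2|)%N.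

(* [q] is the list of the positions visited after the starting point [a]. *)
Definition directed_path (a c : box) (q : seq box) : bool :=
  [&& path (fun u v => grid_dist u v == 1%N) a q, last a q == c
    & size q == grid_dist a c].

(* There are finitely many directed paths from [a] to [c], and at least one,
   so this supremum is a maximum. *)
Definition last_passage (R : realType) (x : box -> R) (a c : box) : R :=
  sup [set \sum_(u <- a :: q) x u | q in [set q | directed_path a c q]].

Definition lpp_tableau (R : realType) (x : box -> R) (b : box) : R :=
  last_passage x (1, 1)%N b.

Definition dual_lpp_tableau (R : realType) (x : box -> R) (b : box) : R :=
  last_passage x (b.1, 1)%N (1, b.2)%N.

Section random_tableaux.
Context d (T : measurableType d) (R : realType) (P : probability T R).

Definition geometric_rv (G : {RV P >-> R}) : Prop :=
  exists (k : nat) (p : R), 0 < p < 1 /\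
    forall m : nat, (k <= m)%N ->
      P (G @^-1` [set m%:R]) = (p * (1 - p) ^+ (m - k))%:E.

Definition exponential_rv (G : {RV P >-> R}) : Prop :=
  exists alpha : R, 0 < alpha /\
    forall A : set R, measurable A ->
      distribution P G A = exponential_prob alpha A.

Definition independent_on (D : {fset box}) (X : box -> {RV P >-> R}) : Prop :=
  forall (J : {fset box}) (A : box -> set R), J `<=` D ->
    (forall b, measurable (A b)) ->
    P (\bigcap_(b in [set` J]) (X b @^-1` A b)) =
    (\prod_(b <- J) P (X b @^-1` A b))%E.

Definition identically_distributed_on (D : {fset box})
    (X : box -> {RV P >-> R}) : Prop :=
  forall b c, b \in D -> c \in D ->
    forall A : set R, measurable A ->
      distribution P (X b) A = distribution P (X c) A.

Definition iid_on (D : {fset box}) (X : box -> {RV P >-> R}) : Prop :=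
  independent_on D X /\ identically_distributed_on D X.

(* The family indexed by [B] is read as a tuple along the enumeration of [B];
   tuples carry the product sigma-algebra. *)
Definition joint_law (B : {fset box}) (Y : box -> T -> R) :
    set ((size B).-tuple R) -> \bar R :=
  pushforward P (fun w => map_tuple (Y ^~ w) (in_tuple B)).

Definition eq_joint_law (B : {fset box}) (Y Z : box -> T -> R) : Prop :=
  forall A : set ((size B).-tuple R), measurable A ->
    joint_law Y A = joint_law Z A.

End random_tableaux.

(* Main.v *)
Require Import Defs.
From HB Require Import structures.
From mathcomp Require Import all_boot all_order all_algebra.
From mathcomp Require Import finmap zify ring lra.
From mathcomp Require Import all_classical all_reals all_analysis.
From mathcomp Require Import measurable_realfun.

(** The proof goes through the RSK and Burge correspondences. Both attach a
    partition to every vertex [(i, j)] of the grid: each box [(i+1, j+1)] carries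
    a local rule which, for fixed partitions [mu], [nu] at its two intermediate
    corners, is a bijection between pairs (partition [lam] at [(i, j)], entry [x])
    and partitions [rho] at [(i+1, j+1)], with
    [|rho| + |lam| = |mu| + |nu| + x]. Removing corners one at a time, the
    partitions along the border of the diagram determine the tableau, and every
    interlacing family occurs. Composing Burge with inverse RSK therefore gives
    a bijection of tableaux that preserves the sum of the entries, hence the law
    of i.i.d. geometric entries, and that preserves the border partitions.

    The first part of the RSK partition at [(i, j)] obeys the recursion for
    [L (i, j)]. For Burge, the partitions at height [i] are built by inserting
    row [i] into the lines of height [i - 1]; each elementary step replaces two
    consecutive lines by their melon, which does not change passage times
    through them from any entrance data. So the first part at [(i, j)] is the
    passage time through rows [i], ..., [1], that is [L* (i, j)].

    Exponential entries [X] are approximated by the geometric variables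
    [floor (2 ^ K X)]: the events [L b > t b], for all [b], are increasing
    limits of the corresponding discrete events, and such events determine the
    joint law. *)

Set Implicit Arguments.
Unset Strict Implicit.
Unset Printing Implicit Defensive.
Import Order.TTheory GRing.Theory Num.Theory.
Import numFieldNormedType.Exports.

(** * Local growth rules *)

(** The skew shape [q / p] is a horizontal strip. This forces both sequences to be nonincreasing, so
    they are partitions once they vanish eventually. *)
Definition interlace (p q : nat -> nat) :=
  forall m, p m <= q m /\ q m.+1 <= p m.

Definition zero_from (i : nat) (p : nat -> nat) := forall m, i <= m -> p m = 0.

(* A partition is the sequence of its parts, indexed from [0]; [lam], [mu], [nu]
   and [rho] sit at the vertices [(i, j)], [(i, j+1)], [(i+1, j)] and
   [(i+1, j+1)], and [x] is the entry of the box [(i+1, j+1)]. *)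
Record growth_rule := GrowthRule {
  step :> nat -> (nat -> nat) -> (nat -> nat) -> (nat -> nat) -> nat ->
    (nat -> nat) -> Prop;
  step_interlace : forall i lam mu nu x rho,
    interlace lam mu -> interlace lam nu ->
    zero_from i mu -> zero_from i.+1 nu -> step i lam mu nu x rho ->
    [/\ interlace mu rho, interlace nu rho & zero_from i.+1 rho];
  step_size : forall i lam mu nu x rho,
    interlace lam mu -> interlace lam nu ->
    zero_from i mu -> zero_from i.+1 nu -> step i lam mu nu x rho ->
    \sum_(m < i.+1) rho m + \sum_(m < i) lam m =
    \sum_(m < i) mu m + \sum_(m < i.+1) nu m + x;
  step_fun : forall i lam mu nu x rho rho',
    step i lam mu nu x rho -> step i lam mu nu x rho' -> rho =1 rho';
  step_inj : forall i lam lam' mu nu x x' rho,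
    interlace lam mu -> interlace lam nu ->
    interlace lam' mu -> interlace lam' nu ->
    zero_from i mu -> zero_from i.+1 nu ->
    step i lam mu nu x rho -> step i lam' mu nu x' rho ->
    lam =1 lam' /\ x = x';
  step_surj : forall i mu nu rho,
    interlace mu rho -> interlace nu rho ->
    zero_from i mu -> zero_from i.+1 nu -> zero_from i.+1 rho ->
    exists lam x,
      [/\ interlace lam mu, interlace lam nu & step i lam mu nu x rho] }.

Lemma sum_ord_recr (f : nat -> nat) n :
  \sum_(m < n.+1) f m = \sum_(m < n) f m + f n.
Proof. by rewrite big_ord_recr. Qed.

Section rsk_rule.

(** The piecewise-linear form of the RSK local rule. Under interlacing [lam m] is at most
    [minn (mu m) (nu m)], so the truncated subtraction is exact. *)
Definition rsk_step (i : nat) (lam mu nu : nat -> nat) (x : nat)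
    (rho : nat -> nat) : Prop :=
  rho 0 = x + maxn (mu 0) (nu 0) /\
  forall m, rho m.+1 = maxn (mu m.+1) (nu m.+1) + minn (mu m) (nu m) - lam m.

Lemma rsk_step_interlace i lam mu nu x rho :
  interlace lam mu -> interlace lam nu ->
  zero_from i mu -> zero_from i.+1 nu -> rsk_step i lam mu nu x rho ->
  [/\ interlace mu rho, interlace nu rho & zero_from i.+1 rho].
Proof.
move=> h1 h2 z1 z2 [r0 rS]; split.
- case=> [|m]; first by have := h1 0; have := h2 0; have := rS 0; lia.
  by have := h1 m; have := h2 m; have := h1 m.+1; have := h2 m.+1;
     have := rS m; have := rS m.+1; lia.
- case=> [|m]; first by have := h1 0; have := h2 0; have := rS 0; lia.
  by have := h1 m; have := h2 m; have := h1 m.+1; have := h2 m.+1;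
     have := rS m; have := rS m.+1; lia.
- case=> [//|m] im; rewrite rS.
  by have := z1 m im; have := z1 m.+1 (leqW im); have := z2 m.+1 im; lia.
Qed.

Lemma rsk_step_size i lam mu nu x rho :
  interlace lam mu -> interlace lam nu ->
  zero_from i mu -> zero_from i.+1 nu -> rsk_step i lam mu nu x rho ->
  \sum_(m < i.+1) rho m + \sum_(m < i) lam m =
  \sum_(m < i) mu m + \sum_(m < i.+1) nu m + x.
Proof.
move=> h1 h2 z1 z2 [r0 rS].
(* The pending term [minn (mu n) (nu n)] is absorbed by part [n.+1] of [rho]; at [n = i] it vanishes
   because [mu i = 0]. *)
suff H n : \sum_(m < n.+1) rho m + \sum_(m < n) lam m + minn (mu n) (nu n) =
           \sum_(m < n.+1) mu m + \sum_(m < n.+1) nu m + x.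
  have := H i; rewrite (sum_ord_recr mu) z1//; lia.
elim: n => [|n IH]; first by rewrite !sum_ord_recr !big_ord0; lia.
rewrite (sum_ord_recr rho) (sum_ord_recr lam) (sum_ord_recr mu n.+1).
rewrite (sum_ord_recr nu n.+1).
have := rS n; have := h1 n; have := h2 n; lia.
Qed.

Lemma rsk_step_fun i lam mu nu x rho rho' :
  rsk_step i lam mu nu x rho -> rsk_step i lam mu nu x rho' -> rho =1 rho'.
Proof. by move=> [r0 rS] [r0' rS'] [|m]; rewrite ?r0 ?r0' ?rS ?rS'. Qed.

Lemma rsk_step_inj i lam lam' mu nu x x' rho :
  interlace lam mu -> interlace lam nu ->
  interlace lam' mu -> interlace lam' nu ->
  zero_from i mu -> zero_from i.+1 nu ->
  rsk_step i lam mu nu x rho -> rsk_step i lam' mu nu x' rho ->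
  lam =1 lam' /\ x = x'.
Proof.
move=> h1 h2 h3 h4 _ _ [r0 rS] [r0' rS']; split; last by lia.
move=> m; have := h1 m; have := h2 m; have := h3 m; have := h4 m.
have := rS m; have := rS' m; lia.
Qed.

Lemma rsk_step_surj i mu nu rho :
  interlace mu rho -> interlace nu rho ->
  zero_from i mu -> zero_from i.+1 nu -> zero_from i.+1 rho ->
  exists lam x,
    [/\ interlace lam mu, interlace lam nu & rsk_step i lam mu nu x rho].
Proof.
move=> h1 h2 _ _ _.
exists (fun m => maxn (mu m.+1) (nu m.+1) + minn (mu m) (nu m) - rho m.+1).
exists (rho 0 - maxn (mu 0) (nu 0)); split.
- by move=> m; have := h1 m; have := h2 m; have := h1 m.+1;
  have := h2 m.+1; lia.
- by move=> m; have := h1 m; have := h2 m; have := h1 m.+1;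
  have := h2 m.+1; lia.
- split; first by have := h1 0; have := h2 0; lia.
  by move=> m; have := h1 m; have := h2 m; have := h1 m.+1;
  have := h2 m.+1; lia.
Qed.

Definition rsk_rule : growth_rule :=
  GrowthRule rsk_step_interlace rsk_step_size rsk_step_fun rsk_step_inj
    rsk_step_surj.

End rsk_rule.

Section burge_rule.

(* The insertion runs from the last part to the first: [t m - nu m] is what is
   carried into part [m], and starts at [x] for [m = i]. *)
Definition burge_step (i : nat) (lam mu nu : nat -> nat) (x : nat)
    (rho : nat -> nat) : Prop :=
  exists t : nat -> nat,
    [/\ t i = nu i + x, rho 0 = t 0,
        forall m, m < i -> rho m.+1 = minn (lam m) (t m.+1),
        forall m, m < i -> t m + lam m + rho m.+1 = mu m + nu m + t m.+1 &
        zero_from i.+1 rho].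

(** As [minn (lam m) (t m.+1)] is at most [t m.+1], the carry satisfies
    [t m >= mu m + nu m - lam m], and [lam m] is below both [mu m] and [nu m]. *)
Lemma burge_carry_ge i lam mu nu x rho t :
  interlace lam mu -> interlace lam nu -> zero_from i mu ->
  t i = nu i + x ->
  (forall m, m < i -> rho m.+1 = minn (lam m) (t m.+1)) ->
  (forall m, m < i -> t m + lam m + rho m.+1 = mu m + nu m + t m.+1) ->
  forall m, m <= i -> maxn (mu m) (nu m) <= t m.
Proof.
move=> h1 h2 z1 ti rS tS m; rewrite leq_eqVlt => /predU1P[->|mi].
  by rewrite z1// ti; lia.
by have := rS m mi; have := tS m mi; have := h1 m; have := h2 m; lia.
Qed.

Lemma burge_step_interlace i lam mu nu x rho :
  interlace lam mu -> interlace lam nu ->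
  zero_from i mu -> zero_from i.+1 nu -> burge_step i lam mu nu x rho ->
  [/\ interlace mu rho, interlace nu rho & zero_from i.+1 rho].
Proof.
move=> h1 h2 z1 z2 [t [ti r0 rS tS z]].
have tge := burge_carry_ge h1 h2 z1 ti rS tS.
have up m : maxn (mu m) (nu m) <= rho m.
  case: m => [|m]; first by rewrite r0 tge.
  case: (ltnP m i) => mi; last by rewrite z1 ?z2//; lia.
  by rewrite rS//; have := tge _ mi; have := h1 m; have := h2 m; lia.
have lo m : rho m.+1 <= minn (mu m) (nu m).
  case: (ltnP m i) => mi; last by rewrite z.
  by rewrite rS//; have := h1 m; have := h2 m; lia.
by split=> // m; have := up m; have := lo m; lia.
Qed.

Lemma burge_step_size i lam mu nu x rho :
  interlace lam mu -> interlace lam nu ->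
  zero_from i mu -> zero_from i.+1 nu -> burge_step i lam mu nu x rho ->
  \sum_(m < i.+1) rho m + \sum_(m < i) lam m =
  \sum_(m < i) mu m + \sum_(m < i.+1) nu m + x.
Proof.
move=> _ _ _ _ [t [ti r0 rS tS _]].
suff H n : n <= i -> \sum_(m < n.+1) rho m + \sum_(m < n) lam m =
           \sum_(m < n) mu m + \sum_(m < n) nu m + t n.
  by rewrite H// (sum_ord_recr nu) ti; lia.
elim: n => [|n IH] ni; first by rewrite !sum_ord_recr !big_ord0; lia.
rewrite (sum_ord_recr rho) (sum_ord_recr lam) (sum_ord_recr mu).
rewrite (sum_ord_recr nu).
by have := IH (ltnW ni); have := tS n ni; lia.
Qed.

Lemma burge_step_fun i lam mu nu x rho rho' :
  burge_step i lam mu nu x rho -> burge_step i lam mu nu x rho' -> rho =1 rho'.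
Proof.
move=> [t [ti r0 rS tS z]] [t' [ti' r0' rS' tS' z']].
have tt' d : d <= i -> t (i - d) = t' (i - d).
  elim: d => [|d IH] di; first by rewrite subn0 ti ti'.
  have e : i - d = (i - d.+1).+1 by lia.
  have l : i - d.+1 < i by lia.
  have := IH (ltnW di); rewrite e.
  by have := rS _ l; have := tS _ l; have := rS' _ l; have := tS' _ l; lia.
case=> [|m]; first by rewrite r0 r0'; have := tt' i; rewrite subnn; apply.
case: (ltnP m i) => mi; last by rewrite z// z'.
by rewrite rS// rS'//; have := tt' (i - m.+1); rewrite subKn//; lia.
Qed.

Lemma burge_step_inj i lam lam' mu nu x x' rho :
  interlace lam mu -> interlace lam nu ->
  interlace lam' mu -> interlace lam' nu ->
  zero_from i mu -> zero_from i.+1 nu ->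
  burge_step i lam mu nu x rho -> burge_step i lam' mu nu x' rho ->
  lam =1 lam' /\ x = x'.
Proof.
move=> h1 h2 h3 h4 z1 z2 [t [ti r0 rS tS z]] [t' [ti' r0' rS' tS' z']].
(* The carries are recovered upwards from [t 0 = rho 0]: once [t m] is known, so are the difference
   of [t m.+1] and [lam m] and their minimum [rho m.+1]. *)
have tt' m : m <= i -> t m = t' m.
  elim: m => [|m IH] mi; first by rewrite -r0 -r0'.
  have := IH (ltnW mi).
  by have := rS _ mi; have := tS _ mi; have := rS' _ mi; have := tS' _ mi; lia.
split; last by have := tt' i; lia.
move=> m; case: (ltnP m i) => mi.
  have := tt' _ mi; have := tt' _ (ltnW mi).
  by have := rS _ mi; have := tS _ mi; have := rS' _ mi; have := tS' _ mi; lia.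
by have := h1 m; have := h3 m; have := z1 m mi; lia.
Qed.

(** Inverts the insertion: [t m.+1] is the minimum [rho m.+1] plus the positive part of
    [t m.+1 - lam m], which truncated subtraction computes. *)
Fixpoint burge_uncarry (mu nu rho : nat -> nat) (m : nat) : nat :=
  if m is m'.+1 then
    rho m + (burge_uncarry mu nu rho m' + rho m - (mu m' + nu m'))
  else rho 0.

Lemma burge_step_surj i mu nu rho :
  interlace mu rho -> interlace nu rho ->
  zero_from i mu -> zero_from i.+1 nu -> zero_from i.+1 rho ->
  exists lam x,
    [/\ interlace lam mu, interlace lam nu & burge_step i lam mu nu x rho].
Proof.
move=> h1 h2 z1 z2 z; set t := burge_uncarry mu nu rho.
have tge m : rho m <= t m by case: m => [//|m]; rewrite /t /= leq_addr.
have tS m : t m.+1 = rho m.+1 + (t m + rho m.+1 - (mu m + nu m)) by [].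
(* Here [lam m] is [rho m.+1] plus the negative part of that same difference. *)
exists (fun m => maxn (rho m.+1) (mu m + nu m - t m)), (t i - nu i); split.
- move=> m; have := h1 m; have := h2 m; have := h1 m.+1; have := h2 m.+1.
  by have := tge m; lia.
- move=> m; have := h1 m; have := h2 m; have := h1 m.+1; have := h2 m.+1.
  by have := tge m; lia.
- exists t; split => //.
  + by have := tge i; have := h2 i; lia.
  + by move=> m mi; have := tS m; lia.
  + by move=> m mi; have := tS m; lia.
Qed.

Definition burge_rule : growth_rule :=
  GrowthRule burge_step_interlace burge_step_size burge_step_fun burge_step_inj
    burge_step_surj.

End burge_rule.

(** * Border partitions determine the tableau *)

Section growth.
Variable s : growth_rule.

Definition growth (x : box -> nat) (F : nat -> nat -> nat -> nat) : Prop :=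
  [/\ forall j, zero_from 0 (F 0 j), forall i, zero_from 0 (F i 0) &
   forall i j, s i (F i j) (F i j.+1) (F i.+1 j) (x (i.+1, j.+1))
     (F i.+1 j.+1)].

Lemma growth_interlace x F : growth x F -> forall i j,
  [/\ interlace (F i j) (F i j.+1), interlace (F i j) (F i.+1 j) &
      zero_from i (F i j)].
Proof.
move=> [F0 Fj0 FS].
have H i : (forall j, interlace (F i j) (F i j.+1) /\ zero_from i (F i j)) /\
           (forall j, interlace (F i j) (F i.+1 j)).
  (* A row passes its properties on to the next by an inner induction on columns, starting from the
     empty partition in column 0. *)
  have aux k :
      (forall j, interlace (F k j) (F k j.+1) /\ zero_from k (F k j)) ->
     forall j, [/\ interlace (F k j) (F k.+1 j), zero_from k.+1 (F k.+1 j) &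
               interlace (F k.+1 j) (F k.+1 j.+1)].
    move=> IH j.
    have [H1 H2] : interlace (F k j) (F k.+1 j) /\ zero_from k.+1 (F k.+1 j).
      elim: j => [|j [H1 H2]].
        by split=> m; rewrite ?Fj0.
      have [h1 z1] := IH j; have [_ z2] := IH j.+1.
      by have [] := step_interlace h1 H1 z2 H2 (FS k j).
    have [h1 z1] := IH j; have [_ z2] := IH j.+1.
    by have [] := step_interlace h1 H1 z2 H2 (FS k j).
  elim: i => [|i [IH1 IH2]].
    have H0 j : interlace (F 0 j) (F 0 j.+1) /\ zero_from 0 (F 0 j).
      by split=> // m; rewrite !F0.
    by split=> // j; have [] := aux _ H0 j.
  have H0 j : interlace (F i.+1 j) (F i.+1 j.+1) /\ zero_from i.+1 (F i.+1 j).
    by have [] := aux _ IH1 j.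
  by split=> // j; have [] := aux _ H0 j.
by move=> i j; have [/(_ j)[? ?] /(_ j)?] := H i.
Qed.

(** By [step_size], crossing a box adds its entry to the difference in size between heights [i.+1]
    and [i], which is 0 in column 0. *)
Lemma growth_row_sum x F : growth x F -> forall i j,
  \sum_(m < i.+1) F i.+1 j m =
  \sum_(m < i) F i j m + \sum_(1 <= l < j.+1) x (i.+1, l).
Proof.
move=> gF i; have [F0 Fj0 FS] := gF; elim=> [|j IH].
  by rewrite big_geq// addn0 !big1// => m _; rewrite Fj0.
have [h1 h2 _] := growth_interlace gF i j.
have [_ _ z1] := growth_interlace gF i j.+1.
have [_ _ z2] := growth_interlace gF i.+1 j.
have := step_size h1 h2 z1 z2 (FS i j).
by rewrite IH [in X in _ -> X]big_nat_recr//=; lia.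
Qed.

Lemma growth_local x y F G : growth x F -> growth y G -> forall i j,
  (forall k l, 0 < k <= i -> 0 < l <= j -> x (k, l) = y (k, l)) ->
  F i j =1 G i j.
Proof.
move=> [F0 Fj0 FS] [G0 Gj0 GS] i j.
elim: i j => [|i IH] j; first by move=> _ m; rewrite F0// G0.
elim: j => [|j IHj] xy m; first by rewrite Fj0// Gj0.
have e1 : F i j = G i j.
  by apply: funext; apply: IH => k l ki lj; apply: xy; lia.
have e2 : F i j.+1 = G i j.+1.
  by apply: funext; apply: IH => k l ki lj; apply: xy; lia.
have e3 : F i.+1 j = G i.+1 j.
  by apply: funext; apply: IHj => k l ki lj; apply: xy; lia.
have := GS i j; rewrite -e1 -e2 -e3 -xy ?leqnn// => GS'.
exact: step_fun (FS i j) GS' m.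
Qed.

End growth.

Local Open Scope fset_scope.

Definition order_ideal (D : {fset box}) : Prop :=
  forall i j, (i, j) \in D -> [/\ 0 < i, 0 < j &
    forall k l, 0 < k <= i -> 0 < l <= j -> (k, l) \in D].

(* The boxes of the diagram are the positive vertices, so its border vertices also
   include the points [(i, 0)] and [(0, j)] beyond the diagram. *)
Definition border_vertex (D : {fset box}) (i j : nat) : bool :=
  [|| i == 0, j == 0 | (i, j) \in D] && ((i.+1, j.+1) \notin D).

(** A box with the largest sum of coordinates has no other box weakly south-east of it. *)
Lemma order_ideal_corner (D : {fset box}) : order_ideal D -> D != fset0 ->
  exists i j, [/\ (i.+1, j.+1) \in D,
    forall k l, (k, l) \in D -> i < k -> j < l -> k = i.+1 /\ l = j.+1 &
    order_ideal (D `\ (i.+1, j.+1))].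
Proof.
move=> oD /fset0Pn[c0 c0D].
have [[[i j] cD] _ cmax] :=
  @arg_maxnP D [` c0D] predT (fun c => ((val c).1 + (val c).2)%N) isT.
have [] := oD _ _ cD; case: i cD cmax => [//|i]; case: j => [//|j].
move=> cD cmax _ _ cle.
exists i, j.
have H k l : (k, l) \in D -> i < k -> j < l -> k = i.+1 /\ l = j.+1.
  by move=> klD ik jl; have := cmax [` klD] isT; rewrite /=; lia.
split=> // k l; rewrite !inE => /andP[ne klD]; have [k0 l0 kll] := oD _ _ klD.
split=> // k' l' k'k l'l; rewrite !inE kll// andbT; apply/eqP => -[e1 e2].
have [] := H k l klD; [lia|lia|] => e3 e4; subst; by rewrite eqxx in ne.
Qed.

Section border_data.
Variable D : {fset box}.

(** The conditions that a growth imposes on its border; [growth_border_surj] shows that they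
    suffice. Away from the border and the axes [F] is unconstrained. *)
Definition border_data (F : nat -> nat -> nat -> nat) : Prop :=
  [/\ forall j, zero_from 0 (F 0 j), forall i, zero_from 0 (F i 0),
      forall i j, border_vertex D i j -> zero_from i (F i j),
      forall i j, border_vertex D i j -> border_vertex D i j.+1 ->
        interlace (F i j) (F i j.+1) &
      forall i j, border_vertex D i j -> border_vertex D i.+1 j ->
        interlace (F i j) (F i.+1 j)].

End border_data.

Lemma growth_border_data s x F D : growth s x F -> border_data D F.
Proof.
move=> gF; have [F0 Fj0 FS] := gF.
by split=> // i j _; have [] := growth_interlace gF i j.
Qed.

Section corner_removal.
Variables (D : {fset box}) (i j : nat).
Hypothesis oD : order_ideal D.
Hypothesis cD : (i.+1, j.+1) \in D.
Hypothesis cmax : forall k l, (k, l) \in D -> i < k -> j < l ->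
  k = i.+1 /\ l = j.+1.

(** At these vertices of the corner box the inverse local rule reads [rho], [mu] and [nu]. *)
Lemma corner_neighbours : [/\ border_vertex D i.+1 j.+1, border_vertex D i j.+1
  & border_vertex D i.+1 j].
Proof.
have [_ _ dn] := oD cD.
have n k l : i < k -> j < l -> (k, l) != (i.+1, j.+1) -> (k, l) \notin D.
  by move=> ik jl; apply: contra => klD; have [-> ->] := cmax klD ik jl.
split; (rewrite /border_vertex n ?andbT;
  [|lia|lia|by apply/eqP => -[]; lia]).
- by rewrite cD !orbT.
- by case: (posnP i) => [->//|i0]; rewrite dn ?orbT//; lia.
- by case: (posnP j) => [->//|j0]; rewrite dn ?orbT//; lia.
Qed.

Lemma border_vertex_corner k l : border_vertex D k l ->
  (k, l) = (i.+1, j.+1) \/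
  [/\ border_vertex (D `\ (i.+1, j.+1)) k l & k <= i \/ l <= j].
Proof.
move=> b; have [e|ne] := eqVneq (k, l) (i.+1, j.+1); [by left|right].
move: b; rewrite /border_vertex !inE ne /= => /andP[h1 h2]; split.
  by rewrite h1 /= negb_and h2 orbT.
case/or3P: h1 => [/eqP->|/eqP->|klD]; [by left|by right|].
case: (leqP k i) => [|ik]; first by left.
case: (leqP l j) => [|jl]; first by right.
by move: ne; have [-> ->] := cmax klD ik jl; rewrite eqxx.
Qed.

(** Deleting the corner box trades the border vertex [(i.+1, j.+1)] for [(i, j)]. By the last
    clause, the entry of the deleted box does not affect the partition at [(k, l)]. *)
Lemma border_vertex_remove k l : border_vertex (D `\ (i.+1, j.+1)) k l ->
  (k, l) = (i, j) \/ [/\ border_vertex D k l, (k, l) <> (i, j),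
     (k, l) <> (i.+1, j.+1) & k <= i \/ l <= j].
Proof.
rewrite /border_vertex !inE => /andP[h1 h2].
have [[-> ->]|ne] := eqVneq (k, l) (i, j); [by left|right].
have bD : [|| k == 0, l == 0 | (k, l) \in D].
  by case/or3P: h1 => [->|->|/andP[_ ->]]; rewrite ?orbT.
split.
- rewrite bD /=; apply: contra h2 => ->; rewrite andbT.
  by apply: contra ne => /eqP[-> ->].
- by move/eqP: ne.
- by move=> [e1 e2]; move: h1; rewrite e1 e2 eqxx.
- case: (leqP k i) => [|ik]; first by left.
  case: (leqP l j) => [|jl]; first by right.
  move: h1; case/or3P => [/eqP k0|/eqP l0|]; [by left; lia|by right; lia|].
  move=> /andP[/eqP n1 klD]; have [e1 e2] := cmax klD ik jl.
  by case: n1; rewrite e1 e2.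
Qed.

End corner_removal.

Section border_bijection.
Variable s : growth_rule.
Variable G : (box -> nat) -> nat -> nat -> nat -> nat.
Hypothesis growthG : forall x, growth s x (G x).

(** Induction on the number of boxes: the inverse local rule at a corner returns its entry and the
    partition at [(i, j)], the new border vertex of the smaller diagram. *)
Lemma growth_border_inj D x y : order_ideal D ->
  (forall i j, border_vertex D i j -> G x i j =1 G y i j) ->
  forall b, b \in D -> x b = y b.
Proof.
move: {2}#|`D| (erefl #|`D|) => n; elim: n D => [|n IH] D.
  by move=> /eqP; rewrite cardfs_eq0 => /eqP ->.
move=> cardD oD xy.
have /(order_ideal_corner oD)[i [j [cD cmax oD0]]] : D != fset0.
  by rewrite -cardfs_gt0 cardD.
have [b1 b2 b3] := corner_neighbours oD cD cmax.
have [_ _ Gx] := growthG x; have [_ _ Gy] := growthG y.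
have [h1 h2 _] := growth_interlace (growthG x) i j.
have [_ _ z1] := growth_interlace (growthG x) i j.+1.
have [_ _ z2] := growth_interlace (growthG x) i.+1 j.
have [h3 h4 _] := growth_interlace (growthG y) i j.
have := Gy i j; move: h3 h4.
have /funext <- := xy _ _ b1; have /funext <- := xy _ _ b2.
have /funext <- := xy _ _ b3 => h3 h4 Gy'.
have [lam_eq x_eq] := step_inj h1 h2 h3 h4 z1 z2 (Gx i j) Gy'.
move=> b bD; have [->|/eqP ne] := b =P (i.+1, j.+1); first exact: x_eq.
apply: (IH (D `\ (i.+1, j.+1))) => //; last by rewrite !inE ne bD.
  by move: cardD; rewrite (cardfsD1 (i.+1, j.+1)) cD /= => -[].
by move=> k l /(border_vertex_remove cD cmax)[[-> ->]//|[kl _ _ _]]; exact: xy.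
Qed.

(** The inverse local rule at a corner yields an entry [a] and a partition [lam]. Induction realizes
    the data with [lam] at [(i, j)]; writing [a] into the corner box then restores the partition at
    [(i.+1, j.+1)]. *)
Lemma growth_border_surj D F : order_ideal D -> border_data D F ->
  exists x, forall i j, border_vertex D i j -> G x i j =1 F i j.
Proof.
move: {2}#|`D| (erefl #|`D|) => n; elim: n D F => [|n IH] D F.
  move=> /eqP; rewrite cardfs_eq0 => /eqP -> _ [F0 Fj0 _ _ _].
  exists (fun=> 0) => i j; rewrite /border_vertex !inE orbF andbT.
  have [G0 Gj0 _] := growthG (fun=> 0).
  by move=> /orP[|] /eqP-> m; rewrite ?G0 ?F0 ?Gj0 ?Fj0.
move=> cardD oD [F0 Fj0 Fz Fh Fv].
have /(order_ideal_corner oD)[i [j [cD cmax oD0]]] : D != fset0.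
  by rewrite -cardfs_gt0 cardD.
have [b1 b2 b3] := corner_neighbours oD cD cmax.
have [lam [a [l1 l2 st]]] :=
  step_surj s (Fv _ _ b2 b1) (Fh _ _ b3 b1) (Fz _ _ b2) (Fz _ _ b3) (Fz _ _ b1).
pose F' k l := if (k, l) == (i, j) then lam else F k l.
have F'ij : F' i j = lam by rewrite /F' eqxx.
have F'ne k l : (k, l) <> (i, j) -> F' k l = F k l.
  by move=> /eqP/negbTE; rewrite /F' => ->.
(* If [(i, j)] lies on an axis, [lam] is squeezed to zero by the empty partition next to it. *)
have i0 : i = 0 -> zero_from 0 lam.
  by move=> i0 m _; have [+ _] := l1 m; rewrite i0 F0// leqn0 => /eqP.
have j0 : j = 0 -> zero_from 0 lam.
  by move=> j0 m _; have [+ _] := l2 m; rewrite j0 Fj0// leqn0 => /eqP.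
have dF' : border_data (D `\ (i.+1, j.+1)) F'.
  split.
  - by move=> l; rewrite /F'; case: eqP => // -[/esym/i0].
  - by move=> k; rewrite /F'; case: eqP => // -[_ /esym/j0].
  - move=> k l /(border_vertex_remove cD cmax)[[-> ->]|[kl ne _ _]].
      rewrite F'ij => m im; have [+ _] := l1 m.
      by rewrite (Fz _ _ b2)// leqn0 => /eqP.
    by rewrite F'ne//; exact: Fz.
  - move=> k l /(border_vertex_remove cD cmax)[[-> ->]|[kl ne nc c]].
      by rewrite F'ij F'ne// => -[]; lia.
    (* The left neighbour of [(i, j)] is not a border vertex, since the box [(i.+1, j)] lies in
       [D]. *)
    move=> /(border_vertex_remove cD cmax)[[e1 e2]|[kl' ne' _ _]].
      subst k j; case/andP: kl => _.
      have [_ _ dn] := oD _ _ cD; rewrite dn//; lia.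
    by rewrite !F'ne//; exact: Fh.
  - move=> k l /(border_vertex_remove cD cmax)[[-> ->]|[kl ne nc c]].
      by rewrite F'ij F'ne// => -[]; lia.
    move=> /(border_vertex_remove cD cmax)[[e1 e2]|[kl' ne' _ _]].
      subst i l; case/andP: kl => _.
      have [_ _ dn] := oD _ _ cD; rewrite dn//; lia.
    by rewrite !F'ne//; exact: Fv.
have [|x Hx] := IH (D `\ (i.+1, j.+1)) F' _ oD0 dF'.
  by move: cardD; rewrite (cardfsD1 (i.+1, j.+1)) cD /= => -[].
pose y b := if b == (i.+1, j.+1) then a else x b.
have yx k l : k <= i \/ l <= j -> G y k l =1 G x k l.
  move=> kl; apply: growth_local (growthG y) (growthG x) _ _ _ => k' l' k'k l'l.
  by rewrite /y; case: eqP => // -[]; lia.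
have yF k l : border_vertex D k l -> (k, l) <> (i.+1, j.+1) -> G y k l =1 F k l.
  move=> kl ne m; case: (border_vertex_corner cmax kl) => [//|[kl' c]].
  rewrite yx// Hx// F'ne// => -[e1 e2].
  by move: kl; rewrite e1 e2 /border_vertex cD andbF.
exists y => k l kl; case: (border_vertex_corner cmax kl) => [|[kl' c]]; last first.
  by apply: yF => // -[]; lia.
move=> [-> ->]; have [_ _ /(_ i j)] := growthG y.
have -> : G y i j = lam.
  apply: funext => m; rewrite yx; last by left.
  rewrite Hx ?F'ij// /border_vertex !inE eqxx /= andbT.
  have [_ _ dn] := oD _ _ cD.
  case: (posnP i) => [//|p]; case: (posnP j) => [//|q].
  by rewrite dn ?andbT; [apply/eqP => -[]; lia|lia|lia].
have /funext -> := yF _ _ b2 ltac:(by case; lia).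
have /funext -> := yF _ _ b3 ltac:(by case; lia).
rewrite /y eqxx => st'; exact: step_fun st' st.
Qed.

End border_bijection.

(** * Sum-preserving transfer between two growth rules *)

Lemma young_diagram_ideal D : young_diagram D -> order_ideal D.
Proof.
move=> [rows rowsP DE] i j; rewrite DE => /and3P[i0 j0 jr]; split=> // k l.
move=> /andP[k0 ki] /andP[l0 lj]; rewrite DE k0 l0.
by have := rowsP k i k0 ki; lia.
Qed.

Lemma young_diagram_sum (D : {fset box}) (rows : nat -> nat) :
  (forall i j, ((i, j) \in D) = [&& 0 < i, 0 < j & j <= rows i]) ->
  exists N, forall f : box -> nat, \sum_(b <- D) f b =
    \sum_(0 <= i < N) \sum_(1 <= j < (rows i.+1).+1) f (i.+1, j).
Proof.
move=> DE; pose N := \max_(b <- D) b.1; exists N => f.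
have NP i j : (i, j) \in D -> (i <= N)%N.
  move=> ijD; exact: (@leq_bigmax_seq _ (enum_fset D) predT (fun b => b.1)
    (i, j) ijD isT).
rewrite (perm_big [seq (i.+1, j) | i <- index_iota 0 N,
                                j <- index_iota 1 (rows i.+1).+1]) /=.
  by rewrite big_allpairs_dep.
apply: uniq_perm; first exact: fset_uniq.
  apply: allpairs_uniq_dep; [exact: iota_uniq|by move=> i _; exact: iota_uniq|].
  by move=> [i j] [k l] _ _ /= [-> ->].
move=> [i j]; apply/idP/allpairsPdep.
  move=> ijD; have := NP _ _ ijD; move: ijD; rewrite DE.
  case: i => // i /andP[_ ij] iN; exists i, j.
  by split; rewrite ?mem_index_iota //; lia.
by move=> [k [l [+ + [-> ->]]]]; rewrite !mem_index_iota DE; lia.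
Qed.

(** With [j] the length of row [i.+1], both [(i, j)] and [(i.+1, j)] are border vertices, so by
    [growth_row_sum] each row sum is a difference of sizes of border partitions. *)
Lemma growth_border_sum s s' x y F G D : young_diagram D ->
  growth s x F -> growth s' y G ->
  (forall i j, border_vertex D i j -> F i j =1 G i j) ->
  \sum_(b <- D) x b = \sum_(b <- D) y b.
Proof.
move=> [rows rowsP DE] gF gG FG.
have [N DN] := young_diagram_sum DE; rewrite !DN.
apply: eq_bigr => i _; apply/eqP; set j := rows i.+1.
have b1 : border_vertex D i.+1 j.
  by rewrite /border_vertex !DE; have := rowsP i.+1 i.+2; lia.
have b2 : border_vertex D i j.
  by rewrite /border_vertex !DE; have := rowsP i i.+1; lia.
rewrite -(eqn_add2l (\sum_(m < i) F i j m)) -(growth_row_sum gF).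
have -> : \sum_(m < i.+1) F i.+1 j m = \sum_(m < i.+1) G i.+1 j m.
  by apply: eq_bigr => m _; exact: FG.
have -> : \sum_(m < i) F i j m = \sum_(m < i) G i j m.
  by apply: eq_bigr => m _; exact: FG.
by rewrite (growth_row_sum gG).
Qed.

Lemma growth_border_local s x y F G D : order_ideal D ->
  growth s x F -> growth s y G -> forall i j, border_vertex D i j ->
  (forall b, b \in D -> x b = y b) -> F i j =1 G i j.
Proof.
move=> oD gF gG i j ij xy.
have [F0 Fj0 _] := gF; have [G0 Gj0 _] := gG.
case/andP: ij => /or3P[/eqP->|/eqP->|ij] _ m.
- by rewrite F0 ?G0.
- by rewrite Fj0 ?Gj0.
have [i0 j0 dn] := oD _ _ ij.
by apply: growth_local gF gG _ _ _ _ => k l ki lj; apply: xy; exact: dn.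
Qed.

(** Finite functions make the tableaux of shape [D] a countable type, over which laws can be summed,
    while growths take entries on all boxes. *)
Definition extend (D : {fset box}) (x : {ffun D -> nat}) (b : box) : nat :=
  if insub b is Some u then x u else 0.

Lemma extendE (D : {fset box}) (x : {ffun D -> nat}) (u : D) :
  extend x (val u) = x u.
Proof. by rewrite /extend valK. Qed.

Lemma sum_extend (D : {fset box}) (x : {ffun D -> nat}) :
  \sum_(b <- D) extend x b = \sum_u x u.
Proof. by rewrite big_seq_fsetE; apply: eq_bigr => u _; exact: extendE. Qed.

Section border_transfer.
Variables (s1 s2 : growth_rule).
Variables G1 G2 : (box -> nat) -> nat -> nat -> nat -> nat.
Hypothesis growthG1 : forall x, growth s1 x (G1 x).
Hypothesis growthG2 : forall x, growth s2 x (G2 x).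
Variable D : {fset box}.
Hypothesis yD : young_diagram D.


Lemma border_transfer_exists (x : {ffun D -> nat}) : exists y : {ffun D -> nat},
  forall i j, border_vertex D i j -> G2 (extend y) i j =1 G1 (extend x) i j.
Proof.
have [y Hy] := growth_border_surj growthG2 (young_diagram_ideal yD)
  (growth_border_data D (growthG1 (extend x))).
exists [ffun u => y (val u)] => i j ij m; rewrite -Hy//.
apply: (growth_border_local (young_diagram_ideal yD)
  (growthG2 _) (growthG2 _) ij) => b bD.
by rewrite -[b]/(val [` bD]) extendE ffunE.
Qed.

End border_transfer.

(** Surjectivity onto border data supplies maps in both directions; injectivity makes them mutually
    inverse. *)
Lemma growth_border_bijection s1 s2
    (G1 G2 : (box -> nat) -> nat -> nat -> nat -> nat)
    (D : {fset box}) :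
  (forall x, growth s1 x (G1 x)) -> (forall x, growth s2 x (G2 x)) ->
  young_diagram D ->
  exists phi : {ffun D -> nat} -> {ffun D -> nat},
    [/\ bijective phi, forall x, \sum_u phi x u = \sum_u x u &
      forall x i j, border_vertex D i j ->
        G2 (extend (phi x)) i j =1 G1 (extend x) i j].
Proof.
move=> gG1 gG2 yD.
have [phi phiP] := choice (border_transfer_exists gG1 gG2 yD).
have [psi psiP] := choice (border_transfer_exists gG2 gG1 yD).
have inj s G x y : (forall x, growth s x (G x)) ->
    (forall i j, border_vertex D i j -> G (extend x) i j =1 G (extend y) i j) ->
    x = y :> {ffun D -> nat}.
  move=> gG xy; apply/ffunP => u; rewrite -!extendE.
  exact: (growth_border_inj gG (young_diagram_ideal yD) xy (valP u)).
exists phi; split => //.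
- exists psi => x.
    by apply: inj gG1 _ => i j ij m; rewrite psiP// phiP.
  by apply: inj gG2 _ => i j ij m; rewrite phiP// psiP.
- move=> x; rewrite -!sum_extend; apply: growth_border_sum yD (gG2 _) (gG1 _) _.
  exact: phiP.
Qed.

Local Close Scope fset_scope.

(** * RSK and Burge growth *)

Section rsk.

Fixpoint rsk_row (prev : nat -> nat -> nat) (y : nat -> nat) (j : nat) :
    nat -> nat :=
  if j is j'.+1 then
    fun m => if m is m'.+1 then
        maxn (prev j m) (rsk_row prev y j' m)
        + minn (prev j m') (rsk_row prev y j' m') - prev j' m'
      else y j + maxn (prev j 0) (rsk_row prev y j' 0)
  else fun=> 0.

Fixpoint rsk (x : box -> nat) (i : nat) : nat -> nat -> nat :=
  if i is i'.+1 then rsk_row (rsk x i') (fun j => x (i, j)) else fun _ _ => 0.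

Lemma growth_rsk x : growth rsk_rule x (rsk x).
Proof. by split => //; case. Qed.

End rsk.

Section burge.

Definition nondecreasing0 (f : nat -> nat) :=
  f 0 = 0 /\ forall j, f j <= f j.+1.

(* [pass g u j] is the maximum over [s <= j] of [u s] plus the increment of [g]
   over the columns [s, ..., j]: the passage times through a row with partial
   sums [g], given the passage times [u] in the preceding row. *)
Fixpoint pass (g u : nat -> nat) (j : nat) : nat :=
  if j is j'.+1 then (g j - g j') + maxn (pass g u j') (u j) else 0.

Lemma nondecreasing0_pass g u : nondecreasing0 (pass g u).
Proof. by split=> // j /=; lia. Qed.

Lemma eq_pass g g' u u' : g =1 g' -> u =1 u' -> pass g u =1 pass g' u'.
Proof. by move=> e e'; elim=> //= j ->; rewrite !e e'. Qed.

(** The upper bound makes the truncated subtraction in [residue] exact. *)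
Lemma pass_le g u : nondecreasing0 g -> nondecreasing0 u ->
  forall j, u j <= pass g u j <= u j + g j.
Proof.
move=> [g0 gS] [u0 uS]; elim=> [|j IH]; first by rewrite u0.
by rewrite /=; have := gS j; have := uS j; lia.
Qed.

Lemma pass0 g : nondecreasing0 g -> pass g (fun=> 0) =1 g.
Proof.
by move=> [g0 gS]; elim=> [//|j IH] /=; rewrite IH; have := gS j; lia.
Qed.

Definition residue (g z : nat -> nat) (j : nat) : nat := z j + g j - pass g z j.

Lemma nondecreasing0_residue g z : nondecreasing0 g -> nondecreasing0 z ->
  nondecreasing0 (residue g z).
Proof.
move=> hg hz; have [g0 gS] := hg; have [z0 zS] := hz.
split; first by rewrite /residue g0 z0.
move=> j; have := pass_le hg hz j; have := pass_le hg hz j.+1.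
by rewrite /residue /=; have := gS j; have := zS j; lia.
Qed.

(* [pass g z] and [residue g z] are the two lines of the melon of [z] and [g]. The
   second component of [H] is the invariant that makes the induction close for
   arbitrary entrance times [u]. *)
Lemma pass_residue g z u : nondecreasing0 g -> nondecreasing0 z ->
  pass g (pass z u) =1 pass (pass g z) (pass (residue g z) u).
Proof.
move=> hg hz; have [g0 gS] := hg; have [z0 zS] := hz.
suff H j : pass g (pass z u) j = pass (pass g z) (pass (residue g z) u) j /\
    pass z u j + pass g z j =
    maxn (pass g (pass z u) j + z j) (pass (residue g z) u j + pass g z j).
  by move=> j; have [] := H j.
elim: j => [|j [IH1 IH2]]; first by rewrite /= z0.
have := pass_le hg hz j; have := pass_le hg hz j.+1.
move: IH1 IH2; rewrite [residue]lock /= -lock.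
rewrite /residue /=; have := gS j; have := zS j.
set a := pass z u j; set b := pass _ u j; set A := pass g _ j.
set B := pass (pass g z) _ j; set Z := pass g z j => zj gj <- inv le1 le0.
(* The residue gains the whole increment of [z] if [Z] dominates [z j.+1], and only [Z - z j]
   otherwise. *)
case: (leqP (z j.+1) Z) => zZ.
  have -> : z j.+1 + g j.+1 - (g j.+1 - g j + Z) - (z j + g j - Z) =
            z j.+1 - z j by lia.
  by split; lia.
have -> : z j.+1 + g j.+1 - (g j.+1 - g j + z j.+1) - (z j + g j - Z) =
          Z - z j by lia.
by split; lia.
Qed.

(** For [m <= n], the line still carried after [z] has passed through lines [n - 1] down to [m] of
    [G]. *)
Fixpoint carry (G : nat -> nat -> nat) (n : nat) (z : nat -> nat) (m : nat) :
    nat -> nat :=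
  if n is n'.+1 then
    if m == n then z else carry G n' (pass (G n') z) m
  else z.

Lemma carry_last G n z : carry G n z n = z.
Proof. by case: n => //= n; rewrite eqxx. Qed.

Lemma carryE G n z m : m < n ->
  carry G n z m = pass (G m) (carry G n z m.+1).
Proof.
elim: n z => // n IH z; rewrite ltnS leq_eqVlt /= => /predU1P[->|mn].
  by rewrite eqxx carry_last ltn_eqF.
by rewrite eqSS !ltn_eqF ?IH// ltnW.
Qed.

(** Each melon leaves its residue behind, one index further down, and carries its other line on; the
    line carried past all others comes first. *)
Definition insert_row (G : nat -> nat -> nat) (n : nat) (z : nat -> nat)
    (m : nat) : nat -> nat :=
  if m is m'.+1 then
    if m' < n then residue (G m') (carry G n z m) else fun=> 0
  else carry G n z 0.

Lemma nondecreasing0_carry G n z m : nondecreasing0 z ->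
  nondecreasing0 (carry G n z m).
Proof.
elim: n z => // n IH z hz /=; case: eqP => // _.
by apply: IH; exact: nondecreasing0_pass.
Qed.

Lemma nondecreasing0_insert_row G n z m :
  (forall k, nondecreasing0 (G k)) -> nondecreasing0 z ->
  nondecreasing0 (insert_row G n z m).
Proof.
move=> hG hz; case: m => [|m] /=; first exact: nondecreasing0_carry.
case: ifP => // _; apply: nondecreasing0_residue => //.
exact: nondecreasing0_carry.
Qed.

Fixpoint pass_rows (G : nat -> nat -> nat) (n : nat) (u : nat -> nat) :
    nat -> nat :=
  if n is n'.+1 then pass_rows G n' (pass (G n') u) else u.

Lemma eq_pass_rows G G' n u u' : (forall m, m < n -> G m =1 G' m) -> u =1 u' ->
  pass_rows G n u =1 pass_rows G' n u'.
Proof.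
elim: n u u' => //= n IH u u' e eu; apply: IH => [m mn|].
  by apply: e; lia.
by apply: eq_pass => //; exact: e.
Qed.

Lemma pass_rows_carry G n z : pass_rows G n z = carry G n z 0.
Proof. by elim: n z => //= n IH z; rewrite IH. Qed.

(** Lines are traversed from the last to the first. [pass_residue] trades [z] and [G n] for the new
    last line and a carried line, which is then inserted into the first [n] lines. *)
Lemma pass_rows_insert_row G n z u : (forall k, nondecreasing0 (G k)) ->
  nondecreasing0 z ->
  pass_rows (insert_row G n z) n.+1 u =1 pass_rows G n (pass z u).
Proof.
move=> hG; elim: n z u => [//|n IH] z u hz j.
rewrite -/(pass_rows _ n.+1 _) [RHS]/=.
have /(eq_pass_rows (fun m (_ : m < n) => frefl (G m))) -> :=
  pass_residue u (hG n) hz.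
rewrite -IH; last exact: nondecreasing0_pass.
apply: (@eq_pass_rows _ _ n.+1) => [m mn|] /=; last by rewrite ltnSn eqxx.
case: m mn => [//|m] /=; rewrite ltnS => mn.
by rewrite mn ltnW ?ltnS//; rewrite eqSS ltn_eqF.
Qed.

Definition row_sum (x : box -> nat) (i j : nat) : nat :=
  \sum_(1 <= l < j.+1) x (i, l).

Lemma row_sumS x i j : row_sum x i j.+1 = row_sum x i j + x (i, j.+1).
Proof. by rewrite /row_sum big_nat_recr. Qed.

Lemma row_sum0 x i : row_sum x i 0 = 0.
Proof. by rewrite /row_sum big_geq. Qed.

Lemma nondecreasing0_row_sum x i : nondecreasing0 (row_sum x i).
Proof. by split=> [|j]; rewrite ?row_sum0// row_sumS leq_addr. Qed.

Fixpoint burge_rows (x : box -> nat) (i : nat) : nat -> nat -> nat :=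
  if i is i'.+1 then insert_row (burge_rows x i') i' (row_sum x i)
  else fun _ _ => 0.

Definition burge (x : box -> nat) (i j m : nat) : nat := burge_rows x i m j.

Lemma nondecreasing0_burge_rows x i m : nondecreasing0 (burge_rows x i m).
Proof.
elim: i m => [//|i IH] m.
exact: nondecreasing0_insert_row (nondecreasing0_row_sum _ _).
Qed.

Lemma growth_burge x : growth burge_rule x (burge x).
Proof.
split=> [//|i m _|i j]; first by have [] := nondecreasing0_burge_rows x i m.
set G := burge_rows x i; set z := row_sum x i.+1.
have hG m : nondecreasing0 (G m) by exact: nondecreasing0_burge_rows.
have hz : nondecreasing0 z by exact: nondecreasing0_row_sum.
have hc m : nondecreasing0 (carry G i z m) by exact: nondecreasing0_carry.
have bS m k : m < i ->
    burge x i.+1 k m.+1 = residue (G m) (carry G i z m.+1) k.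
  by move=> mi; rewrite /burge /= mi.
(* What is carried into part [m] is the increment of the carried line between columns [j] and
   [j.+1]. *)
exists (fun m => burge x i.+1 j m + (carry G i z m j.+1 - carry G i z m j)).
split.
- by rewrite carry_last /z row_sumS addKn.
- by rewrite /burge /= -/G -/z subnKC//; have [_] := hc 0.
- move=> m mi; rewrite !bS// /residue /burge -/G.
  have := pass_le (hG m) (hc m.+1) j; have := pass_le (hG m) (hc m.+1) j.+1.
  have [_ /(_ j)] := hc m.+1; have [_ /(_ j)] := hG m; rewrite /=.
  set a := carry _ _ _ _ j; set b := carry _ _ _ _ j.+1.
  by set c := pass _ _ _; lia.
- move=> m mi; rewrite bS//.
  (* A melon preserves the sum of its two lines; the difference of this identity at [j.+1] and [j]
     is the conservation law of the local rule. *)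
  have em k : burge x i.+1 k m.+1 + carry G i z m k =
      carry G i z m.+1 k + G m k.
    rewrite bS// /residue (carryE G z mi).
    by have := pass_le (hG m) (hc m.+1) k; lia.
  have := em j; have := em j.+1; rewrite -bS//.
  have [_ /(_ j)] := hc m.+1; have [_ /(_ j)] := hG m; have [_ /(_ j)] := hc m.
  by rewrite /burge -/G; lia.
- by case=> // m; rewrite ltnS /burge /= ltnNge => ->.
Qed.

Lemma pass_rows_burge x n u :
  pass_rows (fun m => row_sum x m.+1) n u =1 pass_rows (burge_rows x n) n u.
Proof.
elim: n u => [//|n IH] u j; rewrite [LHS]/= IH.
rewrite [RHS]pass_rows_insert_row//; last exact: nondecreasing0_row_sum.
by move=> k; exact: nondecreasing0_burge_rows.
Qed.

(** From zero entrance times, the first row traversed yields its own partial sums. Carried past all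
    lines of lower height, they become the first line. *)
Lemma burge_first x i :
  (fun j => burge x i j 0) =1 pass_rows (fun m => row_sum x m.+1) i (fun=> 0).
Proof.
case: i => [//|i] j; rewrite /burge /= -pass_rows_carry -pass_rows_burge.
apply: eq_pass_rows => // k; rewrite pass0//; exact: nondecreasing0_row_sum.
Qed.

(* [dual_times x i r l] is the passage time from [(i, 1)] to [(r, l)]. *)
Definition dual_times (x : box -> nat) (i r : nat) : nat -> nat :=
  iteri (i.+1 - r) (fun d => pass (row_sum x (i - d))) (fun=> 0).

Lemma dual_times_ge x i r : i < r -> dual_times x i r = fun=> 0.
Proof. by move=> ir; rewrite /dual_times; have -> : i.+1 - r = 0 by lia. Qed.

Lemma dual_timesS x i r l : r <= i -> dual_times x i r l.+1 =
  x (r, l.+1) + maxn (dual_times x i r l) (dual_times x i r.+1 l.+1).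
Proof.
move=> ri; rewrite /dual_times subSS subSn//= subKn// row_sumS addKn.
by case: l.
Qed.

Lemma dual_times_burge x i j : dual_times x i 1 j = burge x i j 0.
Proof.
rewrite (burge_first x i j); set f := fun m => row_sum x m.+1.
(* After [d] steps, rows [i] down to [i - d + 1] have been traversed. *)
have H d : d <= i -> pass_rows f i (fun=> 0) =
    pass_rows f (i - d) (iteri d (fun d => pass (row_sum x (i - d))) (fun=> 0)).
  elim: d => [|d IH] di; first by rewrite subn0.
  rewrite (IH (ltnW di)); have -> : i - d = (i - d.+1).+1 by lia.
  by rewrite /= /f; have -> : (i - d.+1).+1 = i - d by lia.
by rewrite (H i)// subnn /dual_times subn1.
Qed.

End burge.

(** * Last passage times *)

Local Open Scope classical_set_scope.
Local Open Scope ring_scope.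

(** The position [v] can come just before [c] on a directed path from [a]. *)
Definition pred_step (a v c : box) : Prop :=
  grid_dist v c = 1%N /\ grid_dist a c = (grid_dist a v).+1.

Lemma grid_dist_triangle a b c :
  (grid_dist a c <= grid_dist a b + grid_dist b c)%N.
Proof. by rewrite /grid_dist; lia. Qed.

Lemma grid_dist0 a c : (grid_dist a c == 0%N) = (a == c).
Proof.
apply/eqP/eqP => [|->]; last by rewrite /grid_dist; lia.
by case: a c => [a b] [c d]; rewrite /grid_dist /= => H; congr (_, _); lia.
Qed.

Lemma pred_stepP a c : a != c -> exists v, pred_step a v c.
Proof.
rewrite -grid_dist0; case: a c => [a b] [c d]; rewrite /pred_step /grid_dist /=.
move=> ne; case: (ltngtP a c) => ac.
- by exists (c.-1, d) => /=; lia.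
- by exists (c.+1, d) => /=; lia.
case: (ltngtP b d) => bd.
- by exists (c, d.-1) => /=; lia.
- by exists (c, d.+1) => /=; lia.
- by move: ne; lia.
Qed.

Lemma grid_path_size a q :
  path (fun u v => grid_dist u v == 1%N) a q ->
  (grid_dist a (last a q) <= size q)%N.
Proof.
elim/last_ind: q => [_|q v IH]; first by rewrite leqn0 grid_dist0.
rewrite rcons_path last_rcons size_rcons => /andP[/IH h /eqP d1].
by have := grid_dist_triangle a (last a q) v; lia.
Qed.

Lemma directed_path_nil a c : directed_path a c [::] = (a == c).
Proof.
rewrite /directed_path /= eq_sym; have [->|] := eqVneq a c => //.
by apply/eqP/esym/eqP; rewrite grid_dist0.
Qed.

Lemma directed_path_rcons a c d q : directed_path a c (rcons q d) <->
  [/\ d = c, directed_path a (last a q) q & pred_step a (last a q) c].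
Proof.
rewrite /directed_path rcons_path last_rcons size_rcons /pred_step; split.
  move=> /and3P[/andP[p /eqP d1] /eqP dc /eqP s]; subst d.
  rewrite p eqxx; have := grid_path_size p.
  by have := grid_dist_triangle a (last a q) c; split => //; lia.
move=> [-> /and3P[p _ /eqP s] [d1 d2]]; rewrite p d1 !eqxx /= s d2.
by rewrite eqxx.
Qed.

Lemma directed_path_exists a c : exists q, directed_path a c q.
Proof.
move: {2}(grid_dist a c) (erefl (grid_dist a c)) => n.
elim: n c => [|n IH] c h.
  by exists [::]; rewrite directed_path_nil -grid_dist0 h.
have /pred_stepP[v [v1 v2]] : a != c by rewrite -grid_dist0 h.
have [|q qP] := IH v; first by lia.
exists (rcons q c); apply/directed_path_rcons.
by have /and3P[_ /eqP e _] := qP; rewrite e.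
Qed.

(** Distances add up along a shortest path; this confines directed paths to the rectangle spanned by
    their endpoints. *)
Lemma directed_path_mem a c q u : directed_path a c q -> u \in a :: q ->
  grid_dist a c = (grid_dist a u + grid_dist u c)%N.
Proof.
elim/last_ind: q c => [|q d IH] c.
  by rewrite directed_path_nil inE => /eqP <- /eqP ->; rewrite /grid_dist; lia.
move=> /directed_path_rcons[-> dq [d1 d2]].
rewrite -rcons_cons mem_rcons inE => /predU1P[->|uq].
  by rewrite /grid_dist; lia.
have := IH _ dq uq; have := grid_dist_triangle u (last a q) c.
have := grid_dist_triangle a u c; lia.
Qed.

Lemma directed_path_size a c q : directed_path a c q ->
  size (a :: q) = (grid_dist a c).+1.
Proof. by move=> /and3P[_ _ /eqP /= ->]. Qed.

Section last_passage.
Context {R : realType}.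
Implicit Types (x V : box -> R) (a c : box).

(** In this strict form passage events are unions over paths, which gives both measurability and
    approximation from below. *)
Lemma lt_last_passage x a c t : t < last_passage x a c <->
  exists2 q, directed_path a c q & t < \sum_(u <- a :: q) x u.
Proof.
have [q0 dq0] := directed_path_exists a c.
rewrite /last_passage.
set S := [set \sum_(u <- a :: q) x u | q in [set q | directed_path a c q]].
have S0 : S !=set0 by exists (\sum_(u <- a :: q0) x u), q0.
split=> [/(sup_gt S0)[_ [q dq <-] tq]|[q dq tq]]; first by exists q.
apply: lt_le_trans tq _; apply: ub_le_sup; last by exists q.
(* A square containing every directed path from [a] to [c]; [M] bounds each entry met. *)
set M := \sum_(i < (a.1 + grid_dist a c).+1)
  \sum_(j < (a.2 + grid_dist a c).+1) `|x (i : nat, j : nat)|.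
exists (M *+ (grid_dist a c).+1) => _ [p dp <-].
have -> : M *+ (grid_dist a c).+1 = \sum_(u <- a :: p) M.
  by rewrite big_const_seq count_predT iter_addr_0 (directed_path_size dp).
rewrite big_seq [leRHS]big_seq.
apply: ler_sum => u up; apply: le_trans (ler_norm _) _.
have H (v : box) : grid_dist a c = (grid_dist a v + grid_dist v c)%N ->
    (v.1 < (a.1 + grid_dist a c).+1 /\ v.2 < (a.2 + grid_dist a c).+1)%N.
  by move=> ->; rewrite /grid_dist; lia.
have [h1 h2] := H _ (directed_path_mem dp up).
rewrite /M (bigD1 (Ordinal h1))//= (bigD1 (Ordinal h2))//= -surjective_pairing.
by rewrite -addrA lerDl addr_ge0// ?sumr_ge0// => i _; rewrite sumr_ge0.
Qed.

(** Dynamic programming: the inequality bounds every path sum by [V], and following optimal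
    predecessors attains it. The recursion is required on [Q] only, which must therefore be closed
    under predecessors. *)
Lemma last_passage_eq x V a (Q : pred box) :
  (forall v c, Q c -> pred_step a v c -> Q v) ->
  V a = x a ->
  (forall v c, Q c -> pred_step a v c -> V v + x c <= V c) ->
  (forall c, Q c -> a != c -> exists2 v, pred_step a v c & V c = V v + x c) ->
  forall c, Q c -> last_passage x a c = V c.
Proof.
move=> Qpred Va Vge Vatt c Qc.
have ub q c' : Q c' -> directed_path a c' q -> \sum_(u <- a :: q) x u <= V c'.
  elim/last_ind: q c' => [|q d IH] c' Qc'.
    by rewrite directed_path_nil big_seq1 => /eqP <-; rewrite Va.
  move=> /directed_path_rcons[-> dq st]; rewrite -rcons_cons big_rcons /=.
  apply: le_trans (Vge _ _ Qc' st).
  by rewrite lerD2r; apply: IH => //; exact: Qpred st.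
have att n c' : grid_dist a c' = n -> Q c' ->
    exists2 q, directed_path a c' q & \sum_(u <- a :: q) x u = V c'.
  elim: n c' => [|n IH] c' h Qc'.
    move/eqP: h; rewrite grid_dist0 => /eqP <-.
    by exists [::]; rewrite ?directed_path_nil// big_seq1.
  have [|v st ->] := Vatt _ Qc'; first by rewrite -grid_dist0 h.
  have [||q dq <-] := IH v; [by have [_] := st; lia|exact: Qpred st|].
  exists (rcons q c'); last by rewrite -rcons_cons big_rcons.
  by apply/directed_path_rcons; have /and3P[_ /eqP e _] := dq; rewrite e.
apply/eqP; rewrite eq_le; apply/andP; split; rewrite leNgt; apply/negP.
  by move=> /lt_last_passage[q dq]; rewrite ltNge ub.
have [q dq e] := att _ _ erefl Qc => h.
have : last_passage x a c < last_passage x a c.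
  by apply/lt_last_passage; exists q; rewrite ?e.
by rewrite ltxx.
Qed.


Lemma lpp_tableau_rsk (n : box -> nat) i j :
  lpp_tableau (fun b => (n b)%:R : R) (i.+1, j.+1) = (rsk n i.+1 j.+1 0%N)%:R.
Proof.
pose f k l := rsk n k l 0%N.
have f0 l : f 0%N l = 0%N by [].
have f0r k : f k 0%N = 0%N by case: k.
have fS k l :
    f k.+1 l.+1 = (n (k.+1, l.+1) + maxn (f k l.+1) (f k.+1 l))%N by [].
rewrite /lpp_tableau -/(f _ _).
apply: (@last_passage_eq _ (fun c => (f c.1 c.2)%:R) _
  (fun c => (0 < c.1)%N && (0 < c.2)%N)) => //.
- by move=> [a b] [c d]; rewrite /pred_step /grid_dist /=; lia.
- by rewrite /= fS f0 f0r addn0.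
- move=> [a b] [[|c] [|d]] //= _; rewrite -natrD ler_nat fS => -[].
  rewrite /grid_dist /= => h1 h2.
  have [[-> ->]|[-> ->]] : (a = c /\ b = d.+1) \/ (a = c.+1 /\ b = d) by lia.
    by lia.
  by lia.
- move=> [[|c] [|d]] //= _ ne; rewrite fS.
  have [cd|dc] := leqP (f c d.+1) (f c.+1 d).
    (* In the first column the maximum may sit at the axis vertex [(c.+1, 0)], which no path visits;
       both competitors are then 0 and [(c, 1)] serves instead. *)
    have [d0|d0] := posnP d.
      exists (c, d.+1); last first.
        by move: cd; rewrite /= -natrD d0 f0r leqn0 => /eqP ->; rewrite addnC.
      by move/eqP: ne; rewrite /pred_step /grid_dist d0 /=;
        case: c {cd} => //; lia.
    exists (c.+1, d); first by rewrite /pred_step /grid_dist /=; lia.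
    by rewrite /= -natrD addnC.
  exists (c, d.+1); last by rewrite /= -natrD addnC.
  rewrite /pred_step /grid_dist /=; have [c0|c0] := posnP c; last by lia.
  by move: dc; rewrite c0 f0.
Qed.

Lemma dual_lpp_tableau_burge (n : box -> nat) i j :
  dual_lpp_tableau (fun b => (n b)%:R : R) (i.+1, j.+1) =
  (burge n i.+1 j.+1 0%N)%:R.
Proof.
rewrite -dual_times_burge; pose f k l := dual_times n i.+1 k l.
have f0 l : f i.+2 l = 0%N by rewrite /f dual_times_ge.
have f0r k : f k 0%N = 0%N.
  by rewrite /f /dual_times; case: (i.+2 - k)%N.
have fS k l : (k <= i.+1)%N ->
    f k l.+1 = (n (k, l.+1) + maxn (f k l) (f k.+1 l.+1))%N.
  exact: dual_timesS.
rewrite /dual_lpp_tableau -/(f _ _) /=.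
apply: (@last_passage_eq _ (fun c => (f c.1 c.2)%:R) _
  (fun c => [&& 0 < c.1 <= i.+1 & 0 < c.2]%N)) => //.
- by move=> [a b] [c d]; rewrite /pred_step /grid_dist /=; lia.
- by rewrite /= fS// f0 f0r addn0.
- move=> [a b] [c [|d]] /=; first by rewrite andbF.
  rewrite andbT => /andP[c0 ci] []; rewrite -natrD ler_nat fS//.
  rewrite /grid_dist /= => h1 h2.
  have [[-> ->]|[-> ->]] : (a = c.+1 /\ b = d.+1) \/ (a = c /\ b = d) by lia.
    by lia.
  by lia.
- move=> [c [|d]] /=; first by rewrite andbF.
  rewrite andbT => /andP[c0 ci] /eqP ne; rewrite fS//.
  have [cd|dc] := leqP (f c.+1 d.+1) (f c d).
    have [d0|d0] := posnP d.
      exists (c.+1, d.+1); last first.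
        by move: cd; rewrite /= -natrD d0 f0r leqn0 => /eqP ->; rewrite addnC.
      rewrite /pred_step /grid_dist d0 /=; split; first by lia.
      have : c <> i.+1 by move=> e; apply: ne; rewrite e d0.
      by lia.
    exists (c, d); first by rewrite /pred_step /grid_dist /=; lia.
    by rewrite /= -natrD addnC.
  exists (c.+1, d.+1); last by rewrite /= -natrD addnC.
  rewrite /pred_step /grid_dist /=; split; first by lia.
  have : c <> i.+1 by move=> e; move: dc; rewrite e f0.
  by lia.
Qed.
End last_passage.

(** * Laws of discrete variables and of tuples *)

Section countable_law.
Context d (T : measurableType d) (R : realType).
Variable (mu : {measure set T -> \bar R}).
Variables (I : countType) (f : T -> I).
Hypothesis mf : forall i, measurable (f @^-1` [set i]).

Lemma measurable_countable_preimage (S : set I) : measurable (f @^-1` S).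
Proof.
rewrite (_ : f @^-1` S = \bigcup_k
  (if pickle_inv k is Some i then
     if i \in S then f @^-1` [set i] else set0 else set0)).
  apply: bigcupT_measurable => k; case: pickle_inv => [i|].
    by case: ifP => // _; exact: measurable0.
  exact: measurable0.
apply/seteqP; split=> [w Sw|w [k _]].
  by exists (choice.pickle (f w)) => //; rewrite pickleK_inv mem_set.
by case: pickle_inv => // i; case: ifPn => // /set_mem Si /= ->.
Qed.

Lemma countable_preimage_esum (S : set I) :
  mu (f @^-1` S) = \esum_(i in S) mu (f @^-1` [set i]).
Proof.
pose F (k : nat) := f @^-1` [set i | choice.pickle i = k].
have mF k : measurable (F k) by exact: measurable_countable_preimage.
have -> : f @^-1` S = \bigcup_(k in choice.pickle @` S) F k.
  apply/seteqP; split=> [w Sw|w [_ [i Si <-]]].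
    by exists (choice.pickle (f w)) => //; exists (f w).
  by move=> /(pcan_inj choice.pickleK); rewrite /preimage /= => ->.
rewrite measure_bigcup//; last first.
  by move=> k l _ _ [w [/= <- <-]].
rewrite nneseries_esum//.
rewrite (_ : [set _ | _] = choice.pickle @` S); last first.
  by apply/seteqP; split=> k /=; rewrite inE.
rewrite (@reindex_esum _ _ _ S _ choice.pickle); last first.
  split; first by move=> i Si; exists i.
    by move=> i j _ _; exact: (pcan_inj choice.pickleK).
  by [].
apply: eq_esum => i _; congr (mu _); apply/seteqP; split=> w /=.
  exact: (pcan_inj choice.pickleK).
by rewrite /F /= => ->.
Qed.
End countable_law.

Section tuple_orthants.
Context {R : realType} (n : nat).

Definition orthant (t : 'I_n -> R) : set (n.-tuple R) :=
  [set v | forall i, t i < tnth v i].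


Lemma measurable_orthant t : measurable (orthant t).
Proof.
rewrite (_ : orthant t =
    \bigcap_(i in [set: 'I_n]) (@tnth n R ^~ i @^-1` `]t i, +oo[)).
  apply: fin_bigcap_measurable => // i _; rewrite -[X in measurable X]setTI.
  by apply: measurable_tnth => //; exact: measurable_itv.
by apply/seteqP; split=> v h i; have := h i; rewrite /= in_itv/= andbT// => /(_ I).
Qed.

Lemma tuple_gt_opp (v : n.-tuple R) : 
  exists k : nat, forall j, - k%:R < tnth v j.
Proof.
exists (\sum_j (Num.bound (tnth v j)))%N => j.
rewrite ltrNl (le_lt_trans (ler_norm _))// normrN.
apply: lt_le_trans (archi_boundP (normr_ge0 _)) _; rewrite /Num.bound normr_id.
by rewrite ler_nat (bigD1 j)//= leq_addr.
Qed.

(** Sending all other thresholds to minus infinity leaves a half-space, so orthants generate the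
    product sigma-algebra. *)
Lemma bigcup_orthant (i : 'I_n) (x : R) :
  \bigcup_k orthant (fun j => if j == i then x else - k%:R) =
  @tnth n R ^~ i @^-1` `]x, +oo[.
Proof.
apply/seteqP; split=> [v [k _ /(_ i)]|v] /=; rewrite in_itv/= andbT ?eqxx// => xv.
have [k vk] := tuple_gt_opp v; exists k => // j.
by case: eqP => [->//|_]; exact: vk.
Qed.

Lemma sigma_algebra_orthant :
  @measurable _ (n.-tuple R) = <<s range orthant >>.
Proof.
apply/seteqP; split => [A mA|]; last first.
  apply: smallest_sub; first exact: sigma_algebra_measurable.
  by move=> _ [t _ <-]; exact: measurable_orthant.
have mid : measurable_fun [set: g_sigma_algebraType (range orthant)]
    (id : g_sigma_algebraType (range orthant) -> n.-tuple R).
  apply/measurable_fun_tnthP => i.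
  apply: (measurability _ (RGenOInfty.measurableE R)) => //.
  move=> _ [_ [x ->] <-].
  rewrite setTI; have := bigcup_orthant i x; rewrite /comp /= => <-.
  by apply: bigcupT_measurable => k; apply: sub_sigma_algebra; eexists.
by have := mid measurableT A mA; rewrite setTI.
Qed.

(** Orthants form a pi-system, intersections being given by the maxima of the thresholds, and
    countably many of them cover the space. *)
Lemma eq_law_orthant d (T : measurableType d) (P : probability T R)
    (Y Z : T -> n.-tuple R) :
  measurable_fun setT Y -> measurable_fun setT Z ->
  (forall t, P (Y @^-1` orthant t) = P (Z @^-1` orthant t)) ->
  forall A, measurable A -> P (Y @^-1` A) = P (Z @^-1` A).
Proof.
move=> mY mZ YZ A mA.
pose Y' : {mfun T >-> n.-tuple R} := mfun_Sub (mem_set mY).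
pose Z' : {mfun T >-> n.-tuple R} := mfun_Sub (mem_set mZ).
apply: (@measure_unique _ _ _ (range orthant) (fun k => orthant (fun=> - k%:R))
  sigma_algebra_orthant _ _ _ (pushforward P Y') (pushforward P Z')) => //.
- move=> _ _ [s _ <-] [t _ <-]; exists (fun i => Num.max (s i) (t i)) => //.
  apply/seteqP; split=> [v h|v [h1 h2] i]; last by rewrite gt_max h1 h2.
  by split=> i; have := h i; rewrite gt_max => /andP[].
- by apply/seteqP; split=> // v _; have [k vk] := tuple_gt_opp v; exists k.
- by move=> _ [t _ <-]; exact: YZ.
- move=> k; apply: le_lt_trans (ltry 1); apply: probability_le1.
  rewrite -[X in measurable X]setTI.
  exact: (mY measurableT) (measurable_orthant _).
Qed.

End tuple_orthants.

(** * Passage times of random tableaux *)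

(** The flag [dual] lets [L] and its dual be treated together: [passage false] and [passage true]
    unfold to the two tableaux. *)
Definition passage_start (dual : bool) (b : box) : box :=
  if dual then (b.1, 1%N) else (1%N, 1%N).

Definition passage_end (dual : bool) (b : box) : box :=
  if dual then (1%N, b.2) else b.

Definition passage (R : realType) (dual : bool) (x : box -> R) (b : box) : R :=
  last_passage x (passage_start dual b) (passage_end dual b).

(** Paths for [L] and for its dual have the same length, so a constant shift of the entries shifts
    both passage times equally. *)
Lemma passage_start_end dual b : (0 < b.1)%N -> (0 < b.2)%N ->
  grid_dist (passage_start dual b) (passage_end dual b) = (b.1 + b.2 - 2)%N.
Proof. by case: b => i j; case: dual; rewrite /grid_dist /=; lia. Qed.

Lemma passage_path_mem (D : {fset box}) dual b q u : order_ideal D -> b \in D ->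
  directed_path (passage_start dual b) (passage_end dual b) q ->
  u \in passage_start dual b :: q -> u \in D.
Proof.
case: b => i j oD bD dq uq; have [i0 j0 dn] := oD _ _ bD.
suff H (v : box) :
    grid_dist (passage_start dual (i, j)) (passage_end dual (i, j)) =
    (grid_dist (passage_start dual (i, j)) v +
     grid_dist v (passage_end dual (i, j)))%N -> v \in D.
  exact: H (directed_path_mem dq uq).
case: v => k l; rewrite /grid_dist; case: dual {dq uq} => /= H; apply: dn; lia.
Qed.

Lemma border_strip_vertex (D : {fset box}) b : b \in border_strip D ->
  border_vertex D b.1 b.2.
Proof.
by rewrite !inE /border_vertex -surjective_pairing => /andP[-> ->]; rewrite !orbT.
Qed.

Definition dual_growth (dual : bool) (n : box -> nat) :
    nat -> nat -> nat -> nat :=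
  if dual then burge n else rsk n.

Lemma passage_nat (R : realType) dual (n : box -> nat) b :
  (0 < b.1)%N -> (0 < b.2)%N ->
  passage dual (fun c => (n c)%:R : R) b = (dual_growth dual n b.1 b.2 0%N)%:R.
Proof.
case: b => [[|i] [|j]] // _ _; case: dual.
  exact: dual_lpp_tableau_burge.
exact: lpp_tableau_rsk.
Qed.

Section passage_law.
Context d (T : measurableType d) (R : realType) (P : probability T R).
Variables (D : {fset box}) (X : box -> {RV P >-> R}).
Hypothesis yD : young_diagram D.

Definition passage_orthant (dual : bool) (x : box -> T -> R) (C : {fset box})
    (t : box -> R) : set T :=
  [set w | forall b, b \in C -> t b < passage dual (x ^~ w) b].

Lemma measurable_passage dual b :
  measurable_fun setT (fun w => passage dual (fun c => X c w) b).
Proof.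
apply: (measurability _ (RGenOInfty.measurableE R)) => // _ [_ [t ->] <-].
(* The event is a countable union over paths, enumerated by their codes. *)
rewrite setTI (_ : _ @^-1` _ = \bigcup_k
  (if pickle_inv k is Some q then
     if directed_path (passage_start dual b) (passage_end dual b) q then
     (fun w => \sum_(u <- passage_start dual b :: q) X u w) @^-1` `]t, +oo[
     else set0 else set0)).
  apply: bigcupT_measurable => k; case: pickle_inv => [q|]; last exact: measurable0.
  case: ifP => // _.
  rewrite -[X in measurable X]setTI.
  by apply: measurable_sum => // u; exact: measurable_funPT.
apply/seteqP; split=> [w|w [k _]].
  rewrite /= in_itv/= andbT => /lt_last_passage[q dq tq].
  by exists (choice.pickle q) => //; rewrite pickleK_inv dq/= in_itv/= tq.
case: pickle_inv => // q; case: ifP => // dq; rewrite /= !in_itv/= !andbT => tq.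
by apply/lt_last_passage; exists q.
Qed.

Lemma measurable_passage_orthant dual C t :
  measurable (passage_orthant dual X C t).
Proof.
rewrite (_ : passage_orthant _ _ _ _ = \bigcap_(b in [set` C])
    ((fun w => passage dual (fun c => X c w) b) @^-1` `]t b, +oo[)).
  apply: fin_bigcap_measurable => // b _; rewrite -[X in measurable X]setTI.
  by apply: measurable_passage => //; exact: measurable_itv.
by apply/seteqP; split=> w h b /= bC; have := h b bC; rewrite /= in_itv/= andbT.
Qed.

Hypothesis indX : independent_on D X.

(** A tableau has probability [c ^+ #|D| * q ^+ sum], depending only on the sum of its entries,
    which the bijection between Burge and RSK preserves. The map [g] covers both the shift of
    geometric entries and the rounding of exponential ones. *)
Lemma discrete_passage_law (g : R -> nat) (c q : R) (C : {fset box})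
    (t : box -> R) :
  (forall n, measurable (g @^-1` [set n])) ->
  0 <= c -> 0 <= q ->
  (forall b, b \in D -> forall n,
     P (X b @^-1` (g @^-1` [set n])) = (c * q ^+ n)%:E) ->
  (C `<=` border_strip D)%fset ->
  (forall dual, measurable
     (passage_orthant dual (fun b w => (g (X b w))%:R : R) C t)) /\
  P (passage_orthant false (fun b w => (g (X b w))%:R) C t) =
  P (passage_orthant true (fun b w => (g (X b w))%:R) C t).
Proof.
move=> mg c0 q0 Pg /fsubsetP CD.
pose f w : {ffun D -> nat} := [ffun u : D => g (X (val u) w)].
have fE x : f @^-1` [set x] =
    \bigcap_(b in [set` D]) (X b @^-1` (g @^-1` [set extend x b])).
  apply/seteqP; split=> [w /= <- b bD|w h].
    by rewrite /= -[b]/(val [` bD]%fset) extendE ffunE.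
  by apply/ffunP => u; rewrite ffunE -extendE; exact: h (valP u).
have mf x : measurable (f @^-1` [set x]).
  rewrite fE; apply: fin_bigcap_measurable => // b _.
  exact: measurable_funPTI.
have Pf x : P (f @^-1` [set x]) = (c ^+ #|` D| * q ^+ (\sum_u x u))%:E.
  rewrite fE indX//.
  rewrite big_seq (eq_bigr (fun b => (c * q ^+ extend x b)%:E)); last first.
    by move=> b bD; rewrite Pg.
  rewrite -big_seq prodEFin big_split /= big_const_seq count_predT iter_mulr_1.
  by rewrite -sum_extend prodrXr.
pose S dual : set {ffun D -> nat} := [set x | forall b, b \in C ->
  t b < (dual_growth dual (extend x) b.1 b.2 0%N)%:R].
have SE dual :
    passage_orthant dual (fun b w => (g (X b w))%:R) C t = f @^-1` S dual.
  suff H w b : b \in C -> passage dual (fun c => (g (X c w))%:R : R) b =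
      (dual_growth dual (extend (f w)) b.1 b.2 0%N)%:R.
    by apply/seteqP; split=> w h b bC /=; have := h b bC; rewrite /= ?H.
  move=> /CD bB; have bD : b \in D by move: bB; rewrite !inE => /andP[].
  have oD := young_diagram_ideal yD.
  have [b1 b2 _] : [/\ (0 < b.1)%N, (0 < b.2)%N & True].
    by case: b bD {bB} => i j /oD[].
  rewrite passage_nat//; congr _%:R.
  have H : forall b', b' \in D -> g (X b' w) = extend (f w) b'.
    by move=> b' b'D; rewrite -[b' in RHS]/(val [` b'D]%fset) extendE ffunE.
  case: dual; apply: (growth_border_local oD _ _ (border_strip_vertex bB) H).
  - exact: growth_burge.
  - exact: growth_burge.
  - exact: growth_rsk.
  - exact: growth_rsk.
split=> [dual|]; first by rewrite SE; exact: measurable_countable_preimage.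
rewrite !SE !(countable_preimage_esum P mf).
have [phi [phi_bij phi_sum phiP]] :=
  growth_border_bijection growth_burge growth_rsk yD.
(* Border partitions of RSK at [phi x] are those of Burge at [x], so [phi] maps [S true] onto
   [S false]. *)
rewrite (@reindex_esum _ _ _ (S true) (S false) phi); last first.
  have phiS x : S false (phi x) <-> S true x.
    split=> h b bC; have := h b bC;
    by rewrite /= phiP//; apply: border_strip_vertex; exact: CD.
  split.
  - by move=> x /phiS.
  - by move=> x y _ _; exact: bij_inj phi_bij _ _.
  - move=> x Sx; have [psi psiK phiK] := phi_bij.
    by exists (psi x); rewrite ?phiK//; apply/phiS; rewrite phiK.
apply: eq_esum => x _; apply: etrans (Pf _) _.
by rewrite phi_sum; exact/esym/Pf.
Qed.

End passage_law.

(** * Almost sure events and geometric entries *)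

Lemma probability_eq_on d (T : measurableType d) (R : realType)
    (P : probability T R) (W A B : set T) :
  measurable W -> measurable A -> measurable B -> P W = 1%E ->
  A `&` W = B `&` W -> P A = P B.
Proof.
move=> mW mA mB PW AB.
suff H E : measurable E -> P E = P (E `&` W) by rewrite H// AB -H.
move=> mE; suff P0 : P (E `\` W) = 0%E.
  have -> : P E = (P (E `&` W) + P (E `\` W))%E.
    rewrite -{1}(setUIDK E W); apply: measureU.
    - exact: measurableI.
    - exact: measurableD.
    - by rewrite setDE setIACA setICr setI0.
  by rewrite P0 adde0.
apply/eqP; rewrite eq_le measure_ge0 andbT.
apply: (@le_trans _ _ (P (~` W))).
  apply: le_measure; rewrite ?inE; [exact: measurableD|exact: measurableC|].
  by move=> w [].
by rewrite probability_setC// PW subee.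
Qed.

Lemma measurable_truncn_preimage (R : realType) (a : R) (S : set nat) :
  measurable [set r : R | S (Num.truncn (r * a))].
Proof.
rewrite (_ : [set r | _] = (fun r : R => r * a) @^-1`
    ((fun r : R => Num.truncn r) @^-1` S)) //.
rewrite -[X in measurable X]setTI.
apply: (mulrr_measurable a) => //; apply: measurable_countable_preimage => n.
have mge m : measurable [set r : R | (m < Num.truncn r)%N].
  rewrite (_ : [set r | _] = `[m.+1%:R, +oo[%classic); first exact: measurable_itv.
  by apply/seteqP; split=> r /=; rewrite in_itv/= andbT truncn_gt_nat.
rewrite (_ : _ @^-1` _ = (if n is m.+1 then [set r : R | (m < Num.truncn r)%N]
    else setT) `\` [set r : R | (n < Num.truncn r)%N]).
  by apply: measurableD => //; case: n.
by apply/seteqP; split=> r; case: n => [|n] /=; lia.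
Qed.

Section orthant_law.
Context d (T : measurableType d) (R : realType) (P : probability T R).
Variables (D : {fset box}) (X : box -> {RV P >-> R}).
Hypothesis yD : young_diagram D.
Hypothesis iidX : iid_on D X.

Let indX : independent_on D X. Proof. by have [] := iidX. Qed.

Let oD := young_diagram_ideal yD.

Lemma independent_full (S : set R) : measurable S ->
  (forall b, b \in D -> P (X b @^-1` S) = 1%E) ->
  measurable (\bigcap_(b in [set` D]) (X b @^-1` S)) /\
  P (\bigcap_(b in [set` D]) (X b @^-1` S)) = 1%E.
Proof.
move=> mS PS; split.
  apply: fin_bigcap_measurable => // b _.
  exact: measurable_funPTI.
rewrite (indX (A := fun=> S))//.
by rewrite big_seq big1// => b bD; exact: PS.
Qed.

Let preimage_law (b c : box) (S : set R) : measurable S -> b \in D -> c \in D ->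
  P (X b @^-1` S) = P (X c @^-1` S).
Proof. by move=> mS bD cD; have [_ /(_ b c bD cD S mS)] := iidX. Qed.

Let mpre b (S : set R) : measurable S -> measurable (X b @^-1` S).
Proof. by move=> mS; exact: measurable_funPTI. Qed.

Lemma geometric_orthant_law (C : {fset box}) (t : box -> R) :
  (forall b, b \in D -> geometric_rv (X b)) -> (C `<=` border_strip D)%fset ->
  P (passage_orthant false X C t) = P (passage_orthant true X C t).
Proof.
move=> geoX CD.
have CD' b : b \in C -> b \in D by move/(fsubsetP CD); rewrite !inE => /andP[].
have [D0|/fset0Pn[b0 b0D]] := eqVneq D fset0%fset.
  congr (P _); apply/seteqP; split=> w _ b /CD'; by rewrite D0.
have [k [p [/andP[p0 p1] Pk]]] := geoX _ b0D.
(* The support of the common law; the geometric series shows that it has full probability. *)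
pose S : set R := \bigcup_m [set (k + m)%:R].
have mS : measurable S by apply: bigcupT_measurable => m; exact: measurable_set1.
have PS b : b \in D -> P (X b @^-1` S) = 1%E.
  move=> bD; rewrite (preimage_law mS bD b0D) preimage_bigcup.
  rewrite measure_bigcup//; last first.
    by move=> m m' _ _ [w [/= -> /eqP]]; rewrite eqr_nat eqn_add2l => /eqP.
  have -> : 1%E = (p / (1 - (1 - p)))%:E :> \bar R.
    by rewrite subKr divff ?gt_eqF.
  apply/cvg_lim => //.
  rewrite (_ : (fun _ => _) = EFin \o series (geometric p (1 - p))); last first.
    apply/funext => n /=; rewrite -sumEFin.
    apply: eq_big => [m|m _]; first by rewrite in_setT.
    by rewrite Pk ?leq_addr// addKn.
  apply: cvg_EFin; first by near=> n.
  by apply: cvg_geometric_series; rewrite ger0_norm; lra.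
have [mW PW] := independent_full mS PS; set W := \bigcap_(b in _) _ in mW PW.
pose g (r : R) := (Num.truncn (r * 1) - k)%N.
have mg n : measurable (g @^-1` [set n]).
  exact: (measurable_truncn_preimage 1 [set m | (m - k)%N = n]).
have gE m : g (k + m)%:R = m by rewrite /g mulr1 natrK addKn.
have Pg b : b \in D -> forall n,
    P (X b @^-1` (g @^-1` [set n])) = (p * (1 - p) ^+ n)%:E.
  move=> bD n; rewrite -[in RHS](addKn k n) -Pk ?leq_addr//.
  rewrite -(preimage_law (measurable_set1 _) bD b0D).
  apply: (probability_eq_on (mpre b mS) _ _ (PS b bD)).
  - exact: mpre.
  - exact: mpre _ (measurable_set1 _).
  - apply/seteqP; split=> w [/= h [m _ /= e]].
      by split; [rewrite -h e gE|exists m].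
    by split; [rewrite h gE|exists m].
(* Every path for [b] visits [b.1 + b.2 - 1] boxes, each losing [k]. *)
pose s b := t b - k%:R * (b.1 + b.2 - 1)%:R.
have q0 : 0 <= 1 - p by lra.
have [mE PE] := discrete_passage_law yD indX s mg (ltW p0) q0 Pg CD.
have XE dual : P (passage_orthant dual X C t) =
    P (passage_orthant dual (fun b w => (g (X b w))%:R) C s).
  apply: (probability_eq_on mW _ _ PW) => //; first exact: measurable_passage_orthant.
  suff H w b : W w -> b \in C -> t b < passage dual (X^~ w) b <->
      s b < passage dual (fun c => (g (X c w))%:R) b.
    by apply/seteqP; split=> w [h Ww]; split=> // b bC; apply/H => //; exact: h.
  move=> Ww /CD' bD; have [b1 b2] : (0 < b.1)%N /\ (0 < b.2)%N.
    by case: b bD => i j /oD[].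
  have Xg u : u \in D -> X u w = (g (X u w))%:R + k%:R.
    by move=> uD; have [m _ /= ->] := Ww u uD; rewrite gE natrD addrC.
  have sumE q : directed_path (passage_start dual b) (passage_end dual b) q ->
      \sum_(u <- passage_start dual b :: q) X u w =
      \sum_(u <- passage_start dual b :: q) (g (X u w))%:R +
      k%:R * (b.1 + b.2 - 1)%:R.
    move=> dq; rewrite big_seq (eq_bigr (fun u => (g (X u w))%:R + k%:R)).
      rewrite -big_seq big_split /=; congr (_ + _).
      rewrite big_const_seq count_predT iter_addr_0 (directed_path_size dq).
      rewrite passage_start_end// mulr_natr; congr (_ *+ _).
      by move: b1 b2; clear; case: b => i j /=; lia.
    by move=> u uq; apply: Xg; exact: passage_path_mem dq uq.
  split=> /lt_last_passage[q dq h]; apply/lt_last_passage; exists q => //.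
    by move: h; rewrite sumE// /s ltrBlDr.
  by rewrite sumE// -ltrBlDr.
by rewrite !XE.
Unshelve. all: by end_near. Qed.

End orthant_law.

(** * Exponential entries *)

Lemma exponential_prob_itvNyo (R : realType) (alpha x : R) : 0 <= x ->
  exponential_prob alpha `]-oo, x[ = (1 - expR (- alpha * x))%:E.
Proof.
move=> x0; rewrite /exponential_prob integral_mkcond.
rewrite (_ : _ \_ _ = ((EFin \o exponential_pdf alpha) \_ `[0, x[)); last first.
  apply/funext => y; rewrite !patchE.
  have [y0|y0] := ltP y 0.
    have -> : (y \in `[0, x[%classic) = false.
      by apply/negbTE; rewrite notin_setE /= in_itv/=; lra.
    by case: ifP => // _; rewrite lt0_exponential_pdf.
  congr (if _ then _ else _).
  by apply/idP/idP; rewrite !inE /= !in_itv/= y0.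
rewrite -integral_mkcond integral_itv_bndo_bndc; last first.
  apply/measurable_EFinP; apply: measurable_funTS.
  exact: measurable_exponential_pdf.
move: x0; rewrite le_eqVlt => /predU1P[<-|x0].
  by rewrite set_itv1 integral_set1 mulr0 expR0 subrr.
exact: exponential_prob_itv0c.
Qed.

Section exponential_discretization.
Context d (T : measurableType d) (R : realType) (P : probability T R).
Variables (Y : {RV P >-> R}) (alpha : R).
Hypothesis Yexp : forall A, measurable A ->
  distribution P Y A = exponential_prob alpha A.

Lemma exponential_ge0 : P (Y @^-1` `[0, +oo[) = 1%E.
Proof.
have mY := measurable_funPTI Y (measurable_itv `]-oo, (0 : R)[).
rewrite (_ : _ @^-1` _ = ~` (Y @^-1` `]-oo, 0[)).
  rewrite probability_setC//.
  have := Yexp (measurable_itv `]-oo, 0[).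
  rewrite /distribution /pushforward exponential_prob_itvNyo// => ->.
  by rewrite mulr0 expR0 subrr sube0.
by apply/seteqP; split=> w /=; rewrite !in_itv/= andbT leNgt => /negP.
Qed.

(** The event is a difference of two half-lines, so its probability is a difference of values of the
    distribution function: a geometric law of ratio [expR (- alpha / a)]. *)
Lemma exponential_truncn (a : R) n : 0 < a ->
  P (Y @^-1` [set r | Num.truncn (r * a) = n]) =
  ((1 - expR (- alpha / a)) * expR (- alpha / a) ^+ n)%:E.
Proof.
move=> a0; set q := expR _.
have F m : distribution P Y `]-oo, m%:R / a[ = (1 - q ^+ m)%:E.
  rewrite Yexp; last exact: measurable_itv.
  rewrite exponential_prob_itvNyo ?divr_ge0 ?ler0n ?(ltW a0)// /q -expRM_natl.
  congr (1 - expR _)%:E.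
  by field; rewrite gt_eqF.
have lt_trunc r m : (Num.truncn (r * a) <= m)%N = (r < m.+1%:R / a).
  by rewrite real_truncn_le_nat ?num_real// ltr_pdivlMr.
rewrite -[LHS]/(distribution P Y [set r | Num.truncn (r * a) = n]).
(* For [n = 0] the event is a single half-line, since negative values also truncate to 0. *)
case: n => [|n].
  rewrite expr0 mulr1 -[q]expr1 -F; congr (distribution _ _ _).
  apply/seteqP; split=> r /=; rewrite in_itv/= -lt_trunc.
    by move=> ->.
  by rewrite leqn0 => /eqP.
rewrite (_ : [set r | _] =
    [set` `]-oo, n.+2%:R / a[] `\` [set` `]-oo, n.+1%:R / a[]); last first.
  apply/seteqP; split=> r /=; rewrite !in_itv/= -!lt_trunc.
    by move=> ->; rewrite leqnn ltnn.
  by move=> [h1 /negP h2]; lia.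
rewrite measureD.
- rewrite (_ : _ `&` _ = [set` `]-oo, n.+1%:R / a[]).
    transitivity ((1 - q ^+ n.+2)%:E - (1 - q ^+ n.+1)%:E)%E.
      by congr (_ - _)%E; exact: F.
    by rewrite -EFinB; congr _%:E; rewrite !exprS; ring.
  apply/setIidPr => r /=; rewrite !in_itv/= => /lt_le_trans; apply.
  by rewrite ler_pM2r ?invr_gt0// ler_nat.
- exact: measurable_itv.
- exact: measurable_itv.
- by rewrite -ge0_fin_numE ?measure_ge0// fin_num_measure//; exact: measurable_itv.
Qed.

End exponential_discretization.

Section orthant_law.
Context d (T : measurableType d) (R : realType) (P : probability T R).
Variables (D : {fset box}) (X : box -> {RV P >-> R}).
Hypothesis yD : young_diagram D.
Hypothesis iidX : iid_on D X.

Let dyadic (K : nat) (r : R) : nat := Num.truncn (r * 2 ^+ K).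

(** Makes the rescaled approximations increase with [K]. *)
Let dyadicS K r : (2 * dyadic K r <= dyadic K.+1 r)%N.
Proof.
have [r0|r0] := ltP r 0.
  rewrite /dyadic [in X in (2 * X)%N]truncn_floor.
  by rewrite pmulr_lge0 ?exprn_gt0// leNgt r0.
rewrite /dyadic truncn_ge_nat ?mulr_ge0 ?exprn_ge0// exprS.
have /truncn_itv/andP[h _] : 0 <= r * 2 ^+ K by rewrite mulr_ge0 ?exprn_ge0.
rewrite natrM mulrCA ler_wpM2l//.
Qed.

Let dyadic_gt K r : r * 2 ^+ K - 1 < (dyadic K r)%:R.
Proof. by rewrite ltrBlDr natr1 truncnS_gt. Qed.

Let dyadic_le K r : 0 <= r -> (dyadic K r)%:R <= r * 2 ^+ K.
Proof. by move=> r0; rewrite truncn_le mulr_ge0 ?exprn_ge0. Qed.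

Lemma exponential_orthant_law (C : {fset box}) (t : box -> R) :
  (forall b, b \in D -> exponential_rv (X b)) -> (C `<=` border_strip D)%fset ->
  P (passage_orthant false X C t) = P (passage_orthant true X C t).
Proof.
move=> expX CD; have [indX idX] := iidX; have oD := young_diagram_ideal yD.
have CD' b : b \in C -> b \in D by move/(fsubsetP CD); rewrite !inE => /andP[].
have [D0|/fset0Pn[b0 b0D]] := eqVneq D fset0%fset.
  congr (P _); apply/seteqP; split=> w _ b /CD'; by rewrite D0.
have [alpha [alpha0 Xb0]] := expX _ b0D.
have Xexp b : b \in D -> forall A, measurable A ->
    distribution P (X b) A = exponential_prob alpha A.
  by move=> bD A mA; rewrite (idX b b0 bD b0D A mA); exact: Xb0.
have [mW PW] := independent_full iidX (measurable_itv `[0, +oo[)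
  (fun b bD => exponential_ge0 (Xexp b bD)).
set W := \bigcap_(b in _) _ in mW PW.
have XW w b : W w -> b \in D -> 0 <= X b w.
  by move=> /(_ b) h bD; have := h bD; rewrite /= in_itv/= andbT.
pose E dual K := passage_orthant dual (fun b w => (dyadic K (X b w))%:R : R) C
  (fun b => t b * 2 ^+ K).
have EP K : (forall dual, measurable (E dual K)) /\ P (E false K) = P (E true K).
  have q1 : expR (- alpha / 2 ^+ K) <= 1.
    by rewrite -expR0 ler_expR mulNr oppr_le0 divr_ge0 ?exprn_ge0 ?ltW.
  apply: (@discrete_passage_law _ _ _ _ _ _ yD indX (dyadic K)
    (1 - expR (- alpha / 2 ^+ K)) (expR (- alpha / 2 ^+ K))) => //.
  - by move=> n; exact: (measurable_truncn_preimage _ [set m | m = n]).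
  - by rewrite subr_ge0.
  - move=> b bD n; have K0 : 0 < 2 ^+ K :> R by rewrite exprn_gt0.
    have H := exponential_truncn (Xexp b bD) n K0; exact: H.
have ndb dual w b K L : (K <= L)%N ->
    t b * 2 ^+ K < passage dual (fun c => (dyadic K (X c w))%:R) b ->
    t b * 2 ^+ L < passage dual (fun c => (dyadic L (X c w))%:R) b.
  move=> /subnK <-; elim: (L - K)%N => [//|n IH] /IH; rewrite addSn.
  move: (n + K)%N => M /lt_last_passage[q dq h].
  apply/lt_last_passage; exists q => //.
  rewrite exprS mulrCA; apply: lt_le_trans (_ : 2 * _ <= _).
    by rewrite ltr_pM2l//; exact: h.
  rewrite mulr_sumr; apply: ler_sum => u _.
  by rewrite -natrM ler_nat dyadicS.
have ndE dual K L : (K <= L)%N -> E dual K `<=` E dual L.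
  by move=> KL w Ew b bC; apply: ndb KL _; exact: Ew.
have XE dual : P (passage_orthant dual X C t) = P (\bigcup_K E dual K).
  apply: (probability_eq_on mW _ _ PW) => //; first exact: measurable_passage_orthant.
    by apply: bigcupT_measurable => K; have [] := EP K.
  apply/seteqP; split=> w [h Ww]; split=> //; last first.
    have [K _ EK] := h.
    move=> b bC; have /lt_last_passage[q dq tq] := EK b bC.
    apply/lt_last_passage; exists q => //.
    rewrite -(@ltr_pM2r _ (2 ^+ K)) ?exprn_gt0//; apply: lt_le_trans tq _.
    rewrite mulr_suml big_seq [leRHS]big_seq; apply: ler_sum => u uq.
    apply: dyadic_le; apply: XW => //.
    exact: passage_path_mem (CD' b bC) dq uq.
  have HK b : exists K, b \in C ->
      t b * 2 ^+ K < passage dual (fun c => (dyadic K (X c w))%:R) b.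
    have [bC|] := boolP (b \in C); last by exists 0%N.
    have /lt_last_passage[q dq tq] := h b bC.
    set s := passage_start dual b :: q in tq.
    pose gap := \sum_(u <- s) X u w - t b.
    have gap0 : 0 < gap by rewrite subr_gt0.
    (* Rounding loses at most 1 per box at scale [2 ^+ K]; this [K] makes the total loss smaller
       than the scaled gap. *)
    pose K := Num.bound ((size s)%:R / gap); exists K => _.
    apply/lt_last_passage; exists q => //; rewrite -/s.
    have sK : (size s)%:R < gap * 2 ^+ K.
      rewrite mulrC -ltr_pdivrMr//.
      apply: lt_trans (archi_boundP _) _; first by rewrite divr_ge0 ?ltW.
      by rewrite -natrX ltr_nat ltn_expl.
    apply: (@lt_le_trans _ _ (\sum_(u <- s) (X u w * 2 ^+ K - 1))).
      rewrite big_split /= -mulr_suml big_const_seq count_predT iter_addr_0.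
      by move: sK; rewrite /gap mulNrn; lra.
    by apply: ler_sum => u _; exact/ltW/dyadic_gt.
  have [K HKb] := choice HK.
  (* By monotonicity any common upper bound of the [K b] works, and their sum is one. *)
  exists (\sum_(b <- C) K b)%N => // b bC.
  have KE : (K b <= \sum_(b <- C) K b)%N by rewrite (big_fsetD1 b)//= leq_addr.
  exact: ndb KE (HKb b bC).
rewrite !XE.
have cvgE dual : P (E dual K) @[K --> \oo] --> P (\bigcup_K E dual K).
  apply: nondecreasing_cvg_mu.
  - by move=> K; have [] := EP K.
  - by apply: bigcupT_measurable => K; have [] := EP K.
  - by move=> K L KL; apply/subsetPset; exact: ndE.
rewrite -(cvg_lim _ (cvgE false))// -(cvg_lim _ (cvgE true))//.
by congr (lim _); under eq_fun do rewrite (EP _).2.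
Qed.
End orthant_law.

(** * Corners and joint laws *)

Lemma corners_sub_border_strip (D : {fset box}) : young_diagram D ->
  (corners D `<=` border_strip D)%fset.
Proof.
move=> /young_diagram_ideal oD; apply/fsubsetP => -[i j]; rewrite !inE /=.
move=> /andP[bD /asboolP /young_diagram_ideal oDb].
rewrite bD /=; apply/negP => b1D; have [i0 j0 _] := oD _ _ bD.
(* If [(i.+1, j.+1)] survived the removal of [(i, j)], the remaining diagram would have to contain
   [(i, j)]. *)
have /oDb[_ _ /(_ i j)] : (i.+1, j.+1) \in (D `\ (i, j))%fset.
  by rewrite !inE b1D andbT; apply/eqP => -[]; lia.
by rewrite !inE eqxx /= => H; have := H ltac:(lia) ltac:(lia).
Qed.

Lemma eq_joint_law_orthant d (T : measurableType d) (R : realType)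
    (P : probability T R) (X : box -> {RV P >-> R}) (C : {fset box}) :
  (forall t, P (passage_orthant false X C t) = P (passage_orthant true X C t)) ->
  eq_joint_law P C (fun b w => passage false (fun c => X c w) b)
                   (fun b w => passage true (fun c => X c w) b).
Proof.
move=> Ct A mA; rewrite /joint_law /pushforward.
pose Y dual w :=
  map_tuple ((fun b w => passage dual (fun c => X c w) b) ^~ w) (in_tuple C).
have mY dual : measurable_fun setT (Y dual).
  apply/measurable_fun_tnthP => i; rewrite (_ : _ \o _ =
      fun w => passage dual (fun c => X c w) (tnth (in_tuple C) i)).
    exact: measurable_passage.
  by apply/funext => w; rewrite /= tnth_map.
apply: (@eq_law_orthant _ _ _ _ P (Y false) (Y true)) => //.
(* Thresholds indexed by positions become thresholds indexed by boxes; the default 0 only concerns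
   boxes outside [C]. *)
move=> t; pose s b := if insub (index b C) is Some i then t i else 0.
have H dual : Y dual @^-1` orthant t = passage_orthant dual X C s.
  have sE (i : 'I_(size C)) : s (tnth (in_tuple C) i) = t i.
    rewrite /s (tnth_nth (tnth (in_tuple C) i)) index_uniq ?fset_uniq//.
    by rewrite valK.
  apply/seteqP; split=> w h.
    move=> b bC; have iC : (index b C < size C)%N by rewrite index_mem.
    have := h (Ordinal iC); rewrite tnth_map -sE (tnth_nth b) /= nth_index//.
  by move=> i; rewrite tnth_map -sE; apply: h; exact: mem_tnth.
by rewrite !H.
Qed.

Theorem theorem2p2 (d : measure_display) (T : measurableType d) (R : realType)
    (P : probability T R) (lam : {fset box}) (X : box -> {RV P >-> R}) :
  young_diagram lam ->
  iid_on lam X ->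
  (forall b, b \in lam -> geometric_rv (X b)) \/
  (forall b, b \in lam -> exponential_rv (X b)) ->
  let L := fun (b : box) (w : T) => lpp_tableau (fun c => X c w) b in
  let Ld := fun (b : box) (w : T) => dual_lpp_tableau (fun c => X c w) b in
  eq_joint_law P (border_strip lam) L Ld /\ eq_joint_law P (corners lam) L Ld.
Proof.
move=> ylam iidX lawX L Ld.
have H C : (C `<=` border_strip lam)%fset -> eq_joint_law P C L Ld.
  move=> CB; apply: eq_joint_law_orthant => t; case: lawX => lawX.
    exact: geometric_orthant_law lawX CB.
  exact: exponential_orthant_law lawX CB.
split; apply: H; first exact: fsubset_refl.
exact: corners_sub_border_strip.
Qed.
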